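(* Let $k>0$ and $f(t)=-kt$, and let $\mathbf{g}_f$ be the associated pseudo-Riemannian metric on $\mathbb{H}^2\times\mathbb{C}$ (defined in the context). Then any isometry $h:(\mathbb{H}^2\times\mathbb{C},\mathbf{g}_f)\to(\mathbb{H}^2\times\mathbb{C},\mathbf{g}_f)$ isotopic to the identity (i.e. belonging to the connected component of the identity of the isometry group $\mathrm{Isom}(\mathbb{H}^2\times\mathbb{C},\mathbf{g}_f)$) can be written as $h=P\circ e^{i\theta}$ for some $P\in\mathbb{P}\mathrm{SL}(2,\mathbb{R})$ and $\theta\in\mathbb{R}$.
   Context: Use coordinates $z=x+iy$, $y>0$, on the upper half-plane $\mathbb{H}^2$ and $w=u+iv$ on $\mathbb{C}$. For a smooth function $f:[0,+\infty)\to(-\infty,0]$ with $f(0)=0$, $f'<0$ and $\lim_{t\to+\infty}f(t)=-\infty$, the neutral-signature metric $\mathbf{g}_f$ is given in the basis $\{\partial_x,\partial_y,\partial_u,\partial_v\}$ by $$(\mathbf{g}_f)_{(z,w)}=\begin{pmatrix}\frac{1}{y^2}\big(1-f+3(u^2+v^2)y^3f'\big)&0&2f'vy^2&-2f'uy^2\\0&\frac{1}{y^2}\big(1-f+3(u^2+v^2)y^3f'\big)&2f'uy^2&2f'vy^2\\2f'vy^2&2f'uy^2&\frac43f'y^3&0\\-2f'uy^2&2f'vy^2&0&\frac43f'y^3\end{pmatrix},$$ with $f,f'$ evaluated at $y^3(u^2+v^2)$. A matrix $P=\begin{pmatrix}a&b\\c&d\end{pmatrix}\in\mathrm{SL}(2,\mathbb{R})$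 acts by $P\cdot(z,w)=\big(\frac{az+b}{cz+d},(cz+d)^3w\big)$, and $e^{i\theta}$ acts by $e^{i\theta}\cdot(z,w)=(z,e^{i\theta}w)$. An element of $\mathbb{P}\mathrm{SL}(2,\mathbb{R})$ acts through a representative in $\mathrm{SL}(2,\mathbb{R})$; the two representatives $\pm P$ differ by the rotation $(z,w)\mapsto(z,-w)$. *)

(* Defs.v *)
From HB Require Import structures.
From mathcomp Require Import all_boot all_order all_algebra.
From mathcomp Require Import all_classical all_reals all_analysis.
From mathcomp Require Import complex.

Set Implicit Arguments.
Unset Strict Implicit.
Unset Printing Implicit Defensive.

Import Order.TTheory GRing.Theory Num.Theory.
Import numFieldNormedType.Exports.

Local Open Scope classical_set_scope.
Local Open Scope ring_scope.
Local Open Scope complex_scope.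

(* A point (z, w) = (x + iy, u + iv) is the row vector (x, y, u, v), so that
   H2C is an open subset of R^4 and the global coordinates are a chart. *)
Definition mkpt (R : realType) (z w : R[i]) : 'rV[R]_4 :=
  \row_(j < 4) nth 0 [:: complex.Re z; complex.Im z; complex.Re w; complex.Im w] j.

Definition zcoord (R : realType) (p : 'rV[R]_4) : R[i] := p 0 0 +i* p 0 1.
Definition wcoord (R : realType) (p : 'rV[R]_4) : R[i] := p 0 2 +i* p 0 3.

Definition H2C (R : realType) : set 'rV[R]_4 :=
  [set p | 0 < complex.Im (zcoord p)].
Arguments H2C R : clear implicits.

(* f is a function on R, although only its values at t >= 0 occur; derive1 f 0 is
   the two-sided derivative, which for f smooth on R is the one-sided one. *)
Definition neutral_metric (R : realType) (f : R -> R) (p : 'rV[R]_4) : 'M[R]_4 :=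
  let y := p 0 1 in
  let u := p 0 2 in
  let v := p 0 3 in
  let t := y ^+ 3 * (u ^+ 2 + v ^+ 2) in
  let F := f t in
  let F' := derive1 f t in
  let a := (y ^+ 2)^-1 * (1 - F + 3 * (u ^+ 2 + v ^+ 2) * y ^+ 3 * F') in
  let b := 4 / 3 * F' * y ^+ 3 in
  let c := 2 * F' * v * y ^+ 2 in
  let d := 2 * F' * u * y ^+ 2 in
  \matrix_(i < 4, j < 4)
    nth 0 (nth [::] [:: [:: a; 0; c; - d];
                        [:: 0; a; d; c];
                        [:: c; d; b; 0];
                        [:: - d; c; 0; b]] i) j.

(* Only meaningful for U open. *)
Fixpoint is_Cn (R : realType) (V W : normedModType R) (n : nat) (U : set V)
    (f : V -> W) : Prop :=
  match n with
  | 0 => forall x, U x -> {for x, continuous f}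
  | m.+1 => (forall x, U x -> differentiable f x) /\
            (forall v : V, is_Cn m U (fun x => 'd f x v))
  end.

Definition smooth_on (R : realType) (V W : normedModType R) (U : set V)
    (f : V -> W) : Prop :=
  forall n : nat, is_Cn n U f.

(* A self-map of H2C as a map on R^4. The value off H2C is irrelevant: H2C is
   open, and the derivatives are only taken at points of H2C. *)
Definition in_coords (R : realType) (h : H2C R -> H2C R) : 'rV[R]_4 -> 'rV[R]_4 :=
  'valL_0 (set_val \o h).

Definition diffeomorphism (R : realType) (h : H2C R -> H2C R) : Prop :=
  smooth_on (H2C R) (in_coords h) /\
  exists h' : H2C R -> H2C R,
    [/\ cancel h h', cancel h' h & smooth_on (H2C R) (in_coords h')].

(* The jacobian acts on row vectors (row i holds the i-th partial derivatives),
   so J *m g *m J^T is the matrix of the pulled-back metric. *)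
Definition isometry (R : realType) (g : 'rV[R]_4 -> 'M[R]_4)
    (h : H2C R -> H2C R) : Prop :=
  diffeomorphism h /\
  forall p : H2C R,
    let J := jacobian (in_coords h) (set_val p) in
    J *m g (set_val (h p)) *m J^T = g (set_val p).

(* The isometry group, as a subspace of the self-maps of H2C with the
   compact-open topology. *)
Definition Isom (R : realType) (g : 'rV[R]_4 -> 'M[R]_4) :
    set {compact-open, H2C R -> H2C R} :=
  [set h | isometry g h].

Definition Isom0 (R : realType) (g : 'rV[R]_4 -> 'M[R]_4) :
    set {compact-open, H2C R -> H2C R} :=
  connected_component (Isom g) id.

Definition SL2_act (R : realType) (P : 'M[R]_2) (p : 'rV[R]_4) : 'rV[R]_4 :=
  let z := zcoord p in
  let w := wcoord p in
  let a := (P 0 0)%:C in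
  let b := (P 0 1)%:C in
  let c := (P 1 0)%:C in
  let d := (P 1 1)%:C in
  mkpt ((a * z + b) / (c * z + d)) ((c * z + d) ^+ 3 * w).

Definition rot_act (R : realType) (theta : R) (p : 'rV[R]_4) : 'rV[R]_4 :=
  mkpt (zcoord p) ((cos theta +i* sin theta) * wcoord p).

(* Main.v *)
From HB Require Import structures.
Require Import Defs.
From mathcomp Require Import all_boot all_order all_algebra.
From mathcomp Require Import all_classical all_reals all_analysis.
From mathcomp Require Import ring lra complex.
Import Order.TTheory GRing.Theory Num.Theory.
Import numFieldNormedType.Exports.
Set Implicit Arguments.
Unset Strict Implicit.
Unset Printing Implicit Defensive.
Local Open Scope classical_set_scope.
Local Open Scope ring_scope.

(** Write t = y^3 |w|^2. The metric is (1 + k t) times the hyperbolic metric minus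
    4k/3 times the fibre metric y^3 |Dw|^2, where Dw = dw - (3/2) i w dz / y. It is
    invariant under SL(2, R) and the rotations; the task is to show that an
    isometry h that can be connected to the identity is one of these.

    First, h preserves t. The scalar curvature of the metric is 4 / (1 + k t)
    ([scalar_curvatureE]), an injective function of t, and scalar curvature is
    natural under isometries ([scalar_curvature_natural]).

    Next, h is a bundle map. The gradient of t is a constant multiple of the
    Euler field of the fibres, so h preserves that field ([euler_natural]), hence
    commutes with the dilations of the fibres. Being differentiable along the
    zero section, h has the form (z, w) |-> (phi z, A_z w) with A_z real-linear
    ([fibre_const], [fibre_linear]).

    On the zero section phi is a hyperbolic isometry. It pulls back the three
    coordinates of the hyperboloid model, which span the solutions q of Hess q = q
    g for the hyperbolic metric g, to solutions, that is to combinations of the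
    three coordinates ([hyperbolic_hessian], [hessian_form_pullback]). This makes
    phi a Moebius map z |-> (a z + b) / (c z + d) if it preserves orientation
    ([base_mobius]). The maps A_z are conformal, as h preserves t; if they
    preserve orientation they are multiplications by a complex function rho, and
    the mixed block of the isometry equation reads d rho = 3 c rho dz / (c z + d)
    ([fibre_transport]). So rho = (c z + d)^3 e^(i theta) with theta constant.

    Finally, both orientations are read off values of h, through determinants that
    vanish for no isometry ([base_wedge_neq0], [fibre_wedge_neq0]). Evaluation is
    continuous for the compact-open topology, so on the identity component they
    have the signs that they have at the identity ([connected_sign]). *)

(** * Calculus: mixed partial derivatives and vanishing derivatives *)

Section Calculus.
Context {R : realType}.

(** The derivative along u of F at a point of a line of direction u is an
    ordinary derivative, so the mean value theorem applies along that line. *)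
Lemma is_derive_line (V : normedModType R) (F : V -> R) (p u : V) (a : R) :
  derivable F (p + a *: u) u ->
  is_derive a 1 (fun s : R => F (p + s *: u)) ('D_u F (p + a *: u)).
Proof.
move=> dF.
have E : (fun h : R => h^-1 *: (((fun s : R => F (p + s *: u)) \o shift a) (h *: 1)
                   - F (p + a *: u)))
       = (fun h : R => h^-1 *: ((F \o shift (p + a *: u)) (h *: u) - F (p + a *: u))).
  by apply/funext => h /=; rewrite [_%:A]mulr1 scalerDl addrCA.
by apply: DeriveDef; rewrite /derivable /derive E.
Qed.

(** The mean value theorem along u, then along v, turns the second difference
    into one mixed derivative. The set B stands for the region where the
    hypotheses hold, so that the point found can be located. *)
Lemma second_difference (V : normedModType R) (F : V -> R) (p u v : V) (s : R)
    (B : set V) :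
  0 < s ->
  (forall a b : R, 0 <= a <= s -> 0 <= b <= s -> B (p + b *: v + a *: u)) ->
  (forall q, B q -> derivable F q u /\ derivable ('D_u F) q v) ->
  exists2 q, B q &
    F (p + s *: v + s *: u) - F (p + s *: u) - (F (p + s *: v) - F p) =
    s ^+ 2 * 'D_v ('D_u F) q.
Proof.
move=> s0 sB dB.
have dF a b : 0 <= a <= s -> 0 <= b <= s ->
     let q := p + b *: v + a *: u in derivable F q u /\ derivable ('D_u F) q v.
  by move=> ha hb; apply: dB; exact: sB.
have in0s (x : R) : x \in `]0, s[ -> 0 <= x <= s.
  by rewrite in_itv /= => /andP[x0 xs]; rewrite !ltW.
have s0s : 0 <= s <= s by rewrite lexx ltW.
have s00 : 0 <= (0 : R) <= s by rewrite lexx ltW.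
pose phi (a : R) := F (p + s *: v + a *: u) - F (p + a *: u).
pose dphi (a : R) := 'D_u F (p + s *: v + a *: u) - 'D_u F (p + a *: u).
have phiD a : 0 <= a <= s -> is_derive a 1 phi (dphi a).
  move=> a0s; apply: is_deriveB.
    by have [d _] := dF a s a0s s0s; exact: is_derive_line d.
  have [] := dF a 0 a0s s00; rewrite scale0r addr0 => d _.
  exact: is_derive_line d.
have [| |a a0s] := @MVT _ phi dphi 0 s s0.
- by move=> a /in0s; exact: phiD.
- apply: continuous_in_subspaceT => a; rewrite inE /= in_itv /= => a0s.
  by apply/differentiable_continuous/derivable1_diffP; case: (phiD a a0s).
rewrite {1 2}/phi !scale0r !addr0 subr0 => ->.
pose psi (b : R) := 'D_u F (p + a *: u + b *: v).
have E b : p + a *: u + b *: v = p + b *: v + a *: u by rewrite addrAC.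
have psiD b : 0 <= b <= s ->
    is_derive b 1 psi ('D_v ('D_u F) (p + b *: v + a *: u)).
  move=> b0s; have [_ d] := dF a b (in0s a a0s) b0s.
  by move: d; rewrite -E => d; exact: is_derive_line d.
have [|b b0s] := @MVT _ psi _ 0 s s0 (fun b bs => psiD b (in0s b bs)).
- apply: continuous_in_subspaceT => b; rewrite inE /= in_itv /= => b0s.
  by apply/differentiable_continuous/derivable1_diffP; case: (psiD b b0s).
rewrite /psi scale0r addr0 E subr0 => Eb.
exists (p + b *: v + a *: u); first by apply: sB; exact: in0s.
by rewrite /dphi Eb; ring.
Qed.

(** Used for two mixed derivatives, of which second differences only say that
    they agree at distinct nearby points. *)
Lemma continuous_coincidence (V : normedModType R) (G H : V -> R) (p : V) :
  {for p, continuous G} -> {for p, continuous H} ->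
  (forall r : R, 0 < r -> exists q q', [/\ ball p r q, ball p r q' & G q = H q']) ->
  G p = H p.
Proof.
move=> cG cH GH; apply/eqP; rewrite -subr_eq0 -normr_le0; apply/ler_addgt0Pr => e e0.
rewrite add0r.
have e20 : 0 < e / 2 by rewrite divr_gt0.
have /nbhs_ballP[r /= r0 Br] : nbhs p [set q | `|G p - G q| < e / 2].
  exact: ((cvgrPdist_lt _ _).1 cG _ e20).
have /nbhs_ballP[r' /= r'0 Br'] : nbhs p [set q | `|H p - H q| < e / 2].
  exact: ((cvgrPdist_lt _ _).1 cH _ e20).
have [|q [q' [Bq Bq' E]]] := GH (Num.min r r'); first by rewrite lt_min r0.
have m1 : Num.min r r' <= r by rewrite ge_min lexx.
have m2 : Num.min r r' <= r' by rewrite ge_min lexx orbT.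
have /= B1 := Br _ (le_ball m1 Bq).
have /= B2 := Br' _ (le_ball m2 Bq').
rewrite (splitr e) -(subrKA (G q)) (le_trans (ler_normD _ _))// lerD ?ltW//.
by rewrite E distrC.
Qed.

(** Exchanging u and v does not change the second difference of F on a small
    square, so both mixed derivatives take a common value near p. *)
Lemma clairaut (V : normedModType R) (F : V -> R) (p u v : V) :
  (\forall q \near p, [/\ derivable F q u, derivable F q v,
     derivable ('D_u F) q v & derivable ('D_v F) q u]) ->
  {for p, continuous ('D_v ('D_u F))} -> {for p, continuous ('D_u ('D_v F))} ->
  'D_v ('D_u F) p = 'D_u ('D_v F) p.
Proof.
move=> /nbhs_ballP[r0 /= r00 H0] c1 c2.
apply: (continuous_coincidence c1 c2) => r1 r10.
pose r := Num.min r0 r1.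
have r_gt0 : 0 < r by rewrite lt_min r00.
pose M := `|u| + `|v| + 1.
have M0 : 0 < M by rewrite /M ltr_wpDl// addr_ge0.
pose s := r / 2 / M.
have s0 : 0 < s by rewrite /s !divr_gt0.
have inB a b : 0 <= a <= s -> 0 <= b <= s -> ball p r (p + b *: v + a *: u).
  move=> /andP[a0 as_] /andP[b0 bs].
  rewrite -ball_normE /ball_ /= -addrA opprD addNKr normrN.
  rewrite (le_lt_trans (ler_normD _ _))// !normrZ !ger0_norm//.
  rewrite (@le_lt_trans _ _ (s * M))//.
    rewrite /M !mulrDr mulr1 -addrA addrCA lerD// ?ler_wpM2r//.
    by rewrite -[leLHS]addr0 lerD// ?ler_wpM2r// ltW.
  by rewrite /s divfK ?gt_eqF// ltr_pdivrMr// ltr_pMr// ltr1n.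
have m1 : r <= r0 by rewrite ge_min lexx.
have m2 : r <= r1 by rewrite ge_min lexx orbT.
have Hr q : ball p r q -> _ := fun B => H0 q (le_ball m1 B).
have [| |q Bq E1] := @second_difference V F p u v s (ball p r) s0.
- exact: inB.
- by move=> q /Hr[d1 d2 d3 d4]; split; [exact: d1|exact: d3].
have [| |q' Bq' E2] := @second_difference V F p v u s (ball p r) s0.
- by move=> a b ha hb; rewrite (addrAC p); exact: inB.
- by move=> q' /Hr[d1 d2 d3 d4]; split; [exact: d2|exact: d4].
exists q, q'; split; [exact: le_ball m2 _ Bq|exact: le_ball m2 _ Bq'|].
have s2 : s ^+ 2 != 0 by rewrite expf_neq0 ?gt_eqF.
apply: (mulfI s2); apply: (etrans (esym E1)); apply: etrans E2.
by rewrite (addrAC p (s *: u)); ring.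
Qed.

(** By the mean value theorem along the segment. *)
Lemma segment_const (V : normedModType R) (F : V -> R) (p q : V) :
  (forall s : R, 0 <= s <= 1 -> differentiable F (p + s *: (q - p)) /\
      'D_(q - p) F (p + s *: (q - p)) = 0) ->
  F p = F q.
Proof.
move=> dF; pose f (s : R) := F (p + s *: (q - p)).
have fD (s : R) : 0 <= s <= 1 -> is_derive s 1 f 0.
  move=> s01; have [d <-] := dF s s01; apply: is_derive_line.
  exact: diff_derivable.
have [| |s _] := @MVT _ f (fun=> 0) 0 1 ltr01.
- move=> s; rewrite in_itv /= => /andP[s0 s1]; apply: fD; by rewrite !ltW.
- apply: continuous_in_subspaceT => s; rewrite inE /= in_itv /= => s01.
  by apply/differentiable_continuous/derivable1_diffP; case: (fD s s01).
have pq : p + (q - p) = q by rewrite addrC subrK.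
rewrite /f scale1r scale0r addr0 mul0r pq => /eqP.
by rewrite subr_eq0 => /eqP.
Qed.

End Calculus.

(** * Partial derivatives on row vectors *)

(** Locked, as is [mxpartial]: unification must not unfold derivatives to limits
    when it compares partial derivatives in two different directions. *)
HB.lock Definition partial (R : realType) (n : nat) (i : 'I_n)
  (F : 'rV[R]_n -> R) (p : 'rV[R]_n) : R := 'D_(delta_mx 0 i) F p.

HB.lock Definition mxpartial (R : realType) (n a b : nat) (i : 'I_n)
  (M : 'rV[R]_n -> 'M[R]_(a, b)) (p : 'rV[R]_n) : 'M[R]_(a, b) :=
  \matrix_(c, d) partial i (fun q => M q c d) p.

Section Partial.
Context {R : realType} {n : nat}.
Implicit Types (F G : 'rV[R]_n -> R) (p : 'rV[R]_n) (U : set 'rV[R]_n).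

Lemma eq_on_near U F G p : open U -> U p -> (forall q, U q -> F q = G q) ->
  \forall q \near p, F q = G q.
Proof. by move=> oU Up FG; near=> q; apply: FG; near: q; exact: open_nbhs_nbhs.
Unshelve. all: by end_near. Qed.

Lemma partial_eq_on U F G i p : open U -> U p -> (forall q, U q -> F q = G q) ->
  partial i F p = partial i G p.
Proof.
move=> oU Up FG; rewrite partial.unlock; exact/near_eq_derive/(eq_on_near oU Up FG).
Qed.

(** The differential of F at x is also a first-order expansion of G. *)
Lemma near_eq_differentiable (V W : normedModType R) (F G : V -> W) (x : V) :
  (\forall q \near x, F q = G q) -> differentiable F x -> differentiable G x.
Proof.
move=> FG dF; have [cF EF] := (diff_locallyP _ _).1 dF.
have EG : G \o shift x = cst (G x) + 'd F x +o_ 0 id.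
  apply/eqaddoP => e e0; move/eqaddoP : EF => /(_ e e0).
  have N : \forall h \near (0 : V), F (h + x) = G (h + x).
    by have := FG; rewrite (near_shift 0 x) subr0; apply: filterS => h.
  apply: filterS2 N => h /= E; rewrite !fctE /= -E -(nbhs_singleton FG).
  exact.
apply/diff_locallyP; rewrite (diff_unique cF EG); split; first exact: cF.
exact: EG.
Qed.

Lemma differentiable_eq_on (W : normedModType R) U (F G : 'rV[R]_n -> W) p :
  open U -> U p -> (forall q, U q -> F q = G q) ->
  differentiable F p -> differentiable G p.
Proof.
move=> oU Up FG; apply: near_eq_differentiable.
by near=> q; apply: FG; near: q; exact: open_nbhs_nbhs.
Unshelve. all: by end_near. Qed.

Lemma partialD F G i p : differentiable F p -> differentiable G p ->
  partial i (fun q => F q + G q) p = partial i F p + partial i G p.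
Proof.
by move=> dF dG; rewrite partial.unlock (@deriveD _ _ _ F G)//; exact: diff_derivable.
Qed.

Lemma partialN F i p : differentiable F p ->
  partial i (fun q => - F q) p = - partial i F p.
Proof. by move=> dF; rewrite partial.unlock (@deriveN _ _ _ F)//; exact: diff_derivable. Qed.

Lemma partialM F G i p : differentiable F p -> differentiable G p ->
  partial i (fun q => F q * G q) p = partial i F p * G p + F p * partial i G p.
Proof.
move=> dF dG; rewrite partial.unlock (@deriveM _ _ F G); [|exact: diff_derivable..].
by rewrite addrC; congr (_ + _); rewrite mulrC.
Qed.

Lemma partial_sum m (F : 'I_m -> 'rV[R]_n -> R) i p :
  (forall j, differentiable (F j) p) ->
  partial i (fun q => \sum_j F j q) p = \sum_j partial i (F j) p.
Proof.
move=> dF; rewrite partial.unlock (_ : (fun q => _) = \sum_j F j); last first.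
  by apply/funext => q; rewrite fct_sumE.
by rewrite derive_sum// => j; exact: diff_derivable.
Qed.

Lemma partial_cst (c : R) i p : partial i (fun=> c) p = 0.
Proof. by rewrite partial.unlock derive_cst. Qed.

Lemma partialE F i p : differentiable F p -> partial i F p = 'd F p (delta_mx 0 i).
Proof. by move=> dF; rewrite partial.unlock deriveE. Qed.

Lemma derive_partial F p (v : 'rV[R]_n) : differentiable F p ->
  'D_v F p = \sum_i v 0 i * partial i F p.
Proof.
move=> dF; rewrite deriveE// {1}(row_sum_delta v) linear_sum /=.
by apply: eq_bigr => i _; rewrite linearZ/= partialE.
Qed.

End Partial.

Section Chain.
Context {R : realType} {n m : nat}.

Lemma differentiable_entry (V : normedModType R) a b (M : V -> 'M[R]_(a, b)) p i j :
  differentiable M p -> differentiable (fun q => M q i j) p.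
Proof.
move=> dM; apply: (@differentiable_comp _ _ _ _ M (fun N : 'M[R]_(a, b) => N i j : R)) => //.
exact: differentiable_coord.
Qed.

Lemma diff_entry (V : normedModType R) a b (M : V -> 'M[R]_(a, b)) p i j v :
  differentiable M p -> 'd (fun q => M q i j) p v = 'd M p v i j.
Proof.
move=> dM.
rewrite -deriveE; last exact: differentiable_entry.
rewrite -deriveE// derive_mx ?mxE//; exact: diff_derivable.
Qed.

Lemma partial_comp (h : 'rV[R]_n -> 'rV[R]_m) (G : 'rV[R]_m -> R) i p :
  differentiable h p -> differentiable G (h p) ->
  partial i (fun q => G (h q)) p =
  \sum_b partial i (fun q => h q 0 b) p * partial b G (h p).
Proof.
move=> dh dG; rewrite partialE; last exact: differentiable_comp.
rewrite (@diff_comp _ _ _ _ h G)//= -deriveE// derive_partial//.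
apply: eq_bigr => b _; rewrite [X in _ = X * _]partialE; last exact: (differentiable_entry 0 b dh).
by rewrite diff_entry.
Qed.

End Chain.

Section Smooth.
Context {R : realType} {n : nat}.
Implicit Types (F G : 'rV[R]_n -> R) (U : set 'rV[R]_n).

(** The coordinate form of [is_Cn]: partial derivatives instead of iterated
    differentials, so that functions with values in R suffice. *)
Fixpoint diff_upto (k : nat) U F : Prop :=
  (forall p, U p -> differentiable F p) /\
  if k is l.+1 then forall i, diff_upto l U (partial i F) else True.

Lemma diff_upto_differentiable k U F p : diff_upto k U F -> U p -> differentiable F p.
Proof. by case: k => [|k] [d _]; exact: d. Qed.

Lemma diff_upto_partial k U F i : diff_upto k.+1 U F -> diff_upto k U (partial i F).
Proof. by move=> [_ /(_ i)]. Qed.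

Lemma diff_uptoW k U F : diff_upto k.+1 U F -> diff_upto k U F.
Proof.
elim: k F => [|k IH] F [dF d2F]; split; [exact: dF|exact: I|exact: dF|].
by move=> i; apply: IH; exact: d2F.
Qed.

Lemma diff_upto_eq_on k U F G : open U -> (forall q, U q -> F q = G q) ->
  diff_upto k U F -> diff_upto k U G.
Proof.
move=> oU; elim: k F G => [|k IH] F G FG [dF d2F]; split=> //.
- by move=> p Up; exact: (differentiable_eq_on oU Up FG (dF p Up)).
- by move=> p Up; exact: (differentiable_eq_on oU Up FG (dF p Up)).
- move=> i; apply: IH (d2F i) => q Uq; exact: (partial_eq_on i oU Uq FG).
Qed.

(** By induction on k; values off U matter to neither side because U is open. *)
Lemma is_Cn_diff_upto m k U (f : 'rV[R]_n -> 'rV[R]_m) : open U ->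
  is_Cn k.+1 U f -> forall j, diff_upto k U (fun q => f q 0 j).
Proof.
move=> oU; elim: k f => [|k IH] f.
  by case=> df _ j; split=> // p Up; exact: (differentiable_entry 0 j (df p Up)).
move=> [df d2f] j; split=> [p Up|i].
  exact: (differentiable_entry 0 j (df p Up)).
apply: (diff_upto_eq_on oU) (IH _ (d2f (delta_mx 0 i)) j) => q Uq /=.
rewrite partialE; last exact: (differentiable_entry 0 j (df q Uq)).
by rewrite diff_entry//; exact: df.
Qed.

Lemma partial_comm U F i j p : open U -> diff_upto 2 U F -> U p ->
  partial i (partial j F) p = partial j (partial i F) p.
Proof.
move=> oU dF Up.
have D0 q : U q -> differentiable F q by move=> Uq; exact: diff_upto_differentiable dF Uq.
have D1 k q : U q -> differentiable (partial k F) q.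
  by move=> Uq; exact: diff_upto_differentiable (diff_upto_partial k dF) Uq.
have C2 k l : {for p, continuous (partial k (partial l F))}.
  exact/differentiable_continuous/(diff_upto_differentiable
    (diff_upto_partial k (diff_upto_partial l dF)) Up).
have C1 := C2 i j; have {C2} C2 := C2 j i.
move: D1 C1 C2; rewrite partial.unlock => D1 C1 C2.
apply: clairaut; [|exact: C1|exact: C2].
near=> q; have Uq : U q by near: q; exact: open_nbhs_nbhs.
split; apply: diff_derivable;
  [exact: D0|exact: D0|exact: (D1 j)|exact: (D1 i)].
Unshelve. all: by end_near. Qed.

End Smooth.

(** * Partial derivatives of matrix-valued functions *)

Section MatrixPartial.
Context {R : realType} {n : nat}.
Local Notation V := 'rV[R]_n.

Definition mxdiff a b (M : V -> 'M[R]_(a, b)) p : Prop :=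
  forall c d, differentiable (fun q => M q c d) p.

Lemma mxpartialE a b (l : 'I_n) (M : V -> 'M[R]_(a, b)) p c d :
  mxpartial l M p c d = partial l (fun q => M q c d) p.
Proof. by rewrite mxpartial.unlock mxE. Qed.

Lemma mxpartial_eq_on a b U (M N : V -> 'M[R]_(a, b)) i p : open U -> U p ->
  (forall q, U q -> M q = N q) -> mxpartial i M p = mxpartial i N p.
Proof.
move=> oU Up MN; apply/matrixP => c d; rewrite !mxpartialE.
by apply: (partial_eq_on i oU Up) => q Uq; rewrite MN.
Qed.

Lemma differentiable_bigsum (W : normedModType R) m (F : 'I_m -> V -> W) p :
  (forall j, differentiable (F j) p) ->
  differentiable (fun q => \sum_j F j q) p.
Proof.
move=> dF; rewrite (_ : (fun q => _) = \sum_j F j); first exact: differentiable_sum.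
by apply/funext => q; rewrite fct_sumE.
Qed.

Lemma mxdiffM a b c (M : V -> 'M[R]_(a, b)) (N : V -> 'M[R]_(b, c)) p :
  mxdiff M p -> mxdiff N p -> mxdiff (fun q => M q *m N q) p.
Proof.
move=> dM dN i j; rewrite (_ : (fun q => _) = fun q => \sum_k M q i k * N q k j).
  by apply: differentiable_bigsum => k; exact: differentiableM.
by apply/funext => q; rewrite mxE.
Qed.

Lemma mxpartialM a b c l (M : V -> 'M[R]_(a, b)) (N : V -> 'M[R]_(b, c)) p :
  mxdiff M p -> mxdiff N p ->
  mxpartial l (fun q => M q *m N q) p = mxpartial l M p *m N p + M p *m mxpartial l N p.
Proof.
move=> dM dN; apply/matrixP => i j; rewrite mxE !mxpartialE ![in RHS]mxE.
rewrite (_ : (fun q => _) = fun q => \sum_k M q i k * N q k j); last first.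
  by apply/funext => q; rewrite mxE.
rewrite partial_sum => [|k]; last exact: differentiableM.
rewrite -big_split; apply: eq_bigr => k _ /=.
by rewrite partialM// !mxpartialE.
Qed.

Lemma mxpartialB a b l (M N : V -> 'M[R]_(a, b)) p :
  mxdiff M p -> mxdiff N p ->
  mxpartial l (fun q => M q - N q) p = mxpartial l M p - mxpartial l N p.
Proof.
move=> dM dN; apply/matrixP => i j; rewrite mxpartialE !mxE !mxpartialE.
rewrite (_ : (fun q => _) = fun q => M q i j + - N q i j); last first.
  by apply/funext => q; rewrite !mxE.
by rewrite partialD// ?partialN//; exact: differentiableN.
Qed.

Lemma mxdiff_tr a b (M : V -> 'M[R]_(a, b)) p :
  mxdiff M p -> mxdiff (fun q => (M q)^T) p.
Proof.
move=> dM i j; rewrite (_ : (fun q => _) = fun q => M q j i)//.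
by apply/funext => q; rewrite !mxE.
Qed.

Lemma mxpartial_tr a b l (M : V -> 'M[R]_(a, b)) p :
  mxpartial l (fun q => (M q)^T) p = (mxpartial l M p)^T.
Proof.
apply/matrixP => i j; rewrite mxE !mxpartialE; congr (partial l _ p).
by apply/funext => q; rewrite !mxE.
Qed.

Lemma mxdiff_lincomb a b m (x : 'I_m -> V -> R) (M : 'I_m -> V -> 'M[R]_(a, b)) p :
  (forall k, differentiable (x k) p) -> (forall k, mxdiff (M k) p) ->
  mxdiff (fun q => \sum_k x k q *: M k q) p.
Proof.
move=> dx dM i j; rewrite (_ : (fun q => _) = fun q => \sum_k x k q * M k q i j).
  apply: differentiable_bigsum => k; apply: differentiableM; [exact: dx|exact: dM].
by apply/funext => q; rewrite summxE; apply: eq_bigr => k _; rewrite mxE.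
Qed.

Lemma mxpartial_lincomb a b m l (x : 'I_m -> V -> R) (M : 'I_m -> V -> 'M[R]_(a, b)) p :
  (forall k, differentiable (x k) p) -> (forall k, mxdiff (M k) p) ->
  mxpartial l (fun q => \sum_k x k q *: M k q) p =
  \sum_k (partial l (x k) p *: M k p + x k p *: mxpartial l (M k) p).
Proof.
move=> dx dM; apply/matrixP => i j; rewrite mxpartialE summxE.
rewrite (_ : (fun q => _) = fun q => \sum_k x k q * M k q i j); last first.
  by apply/funext => q; rewrite summxE; apply: eq_bigr => k _; rewrite mxE.
rewrite partial_sum => [|k]; last by apply: differentiableM; [exact: dx|exact: dM].
apply: eq_bigr => k _; rewrite partialM; [|exact: dx|exact: dM].
by rewrite !mxE mxpartialE.
Qed.

Lemma mxdiff_comp a b (h : V -> V) (M : V -> 'M[R]_(a, b)) p :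
  differentiable h p -> mxdiff M (h p) -> mxdiff (fun q => M (h q)) p.
Proof.
by move=> dh dM i j; apply: (@differentiable_comp _ _ _ _ h (fun q => M q i j)).
Qed.

Lemma mxpartial_comp a b l (h : V -> V) (M : V -> 'M[R]_(a, b)) p :
  differentiable h p -> mxdiff M (h p) ->
  mxpartial l (fun q => M (h q)) p =
  \sum_c partial l (fun q => h q 0 c) p *: mxpartial c M (h p).
Proof.
move=> dh dM; apply/matrixP => i j; rewrite mxpartialE summxE.
rewrite (@partial_comp _ _ _ h (fun q => M q i j))//.
by apply: eq_bigr => c _; rewrite mxE mxpartialE.
Qed.

End MatrixPartial.

(** * Scalar curvature is natural under isometries *)

Lemma mulmx_cancelr (F : fieldType) m n (B : 'M[F]_n) (X Y : 'M[F]_(m, n)) :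
  B \in unitmx -> X *m B = Y *m B -> X = Y.
Proof. by move=> uB E; rewrite -(mulmxK uB X) E mulmxK. Qed.

(** The matrix whose row i holds the i-th partial derivatives, for maps that
    need not be differentiable. *)
HB.lock Definition Jac (R : realType) (n : nat) (h : 'rV[R]_n -> 'rV[R]_n)
  (p : 'rV[R]_n) : 'M[R]_n := \matrix_(i, j) partial i (fun q => h q 0 j) p.

Section Curvature.
Context {R : realType} {n : nat}.
Local Notation V := 'rV[R]_n.

Lemma JacE (h : V -> V) p i j : Jac h p i j = partial i (fun q => h q 0 j) p.
Proof. by rewrite Jac.unlock mxE. Qed.

(** Christoffel symbols of the first kind: the entry (i, j) of the l-th matrix is
    [l i, j]. Grouping them in one matrix for each direction l makes the
    connection a matrix-valued one-form. *)
Definition christoffel1 (g : V -> 'M[R]_n) (l : 'I_n) (p : V) : 'M[R]_n :=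
  \matrix_(i, j) ((mxpartial l g p i j + mxpartial i g p l j
                   - mxpartial j g p l i) / 2).

Lemma christoffel1E g l p i j : christoffel1 g l p i j =
  (mxpartial l g p i j + mxpartial i g p l j - mxpartial j g p l i) / 2.
Proof. by rewrite mxE. Qed.

(** The curvature of the connection e_j |-> sum_k (A_l)_jk e_k; the order of the
    products is the one for matrices acting on row vectors. *)
Definition curvature (A : 'I_n -> V -> 'M[R]_n) (l i : 'I_n) (p : V) : 'M[R]_n :=
  mxpartial l (A i) p - mxpartial i (A l) p - A l p *m A i p + A i p *m A l p.

Definition ricci (A : 'I_n -> V -> 'M[R]_n) (p : V) : 'M[R]_n :=
  \matrix_(i, j) \sum_l curvature A l i p j l.

Definition scalar_curvature (g : V -> 'M[R]_n) (A : 'I_n -> V -> 'M[R]_n) (p : V) : R :=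
  \tr (invmx (g p) *m ricci A p).

Context (U : set V) (g : V -> 'M[R]_n) (A : 'I_n -> V -> 'M[R]_n) (h : V -> V).
Hypotheses (oU : open U) (g_diff : forall p, U p -> mxdiff g p)
  (g_sym : forall p, U p -> (g p)^T = g p)
  (g_unit : forall p, U p -> g p \in unitmx)
  (A_diff : forall p l, U p -> mxdiff (A l) p)
  (A_lc : forall p l, U p -> A l p *m g p = christoffel1 g l p)
  (hU : forall p, U p -> U (h p))
  (h_diff : forall p, U p -> differentiable h p)
  (h_diff3 : forall j, diff_upto 3 U (fun q => h q 0 j))
  (h_isom : forall p, U p -> Jac h p *m g (h p) *m (Jac h p)^T = g p).

Local Notation J := (Jac h).

Lemma Jac_entry i j : (fun q => J q i j) = partial i (fun q => h q 0 j).
Proof. by apply/funext => q; rewrite JacE. Qed.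

Lemma Jac_diff p : U p -> mxdiff J p.
Proof.
by move=> Up i j; rewrite (Jac_entry i j);
exact: (diff_upto_differentiable (diff_upto_partial i (h_diff3 j)) Up).
Qed.

Lemma h_diff_upto2 j : diff_upto 2 U (fun q => h q 0 j).
Proof. exact: diff_uptoW (h_diff3 j). Qed.

(** The symmetry of second derivatives of h. *)
Lemma Jac_partial_sym l i p : U p ->
  forall j, mxpartial l J p i j = mxpartial i J p l j.
Proof.
move=> Up j; rewrite !mxpartialE (Jac_entry i j) (Jac_entry l j).
exact: (partial_comm l i oU (h_diff_upto2 j) Up).
Qed.

Lemma Jac_unit p : U p -> J p \in unitmx.
Proof.
move=> Up; have := g_unit Up; rewrite -(h_isom Up) !unitmxE !det_mulmx.
by rewrite !unitrM => /andP[/andP[]].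
Qed.

(** The matrices of the pulled-back connection, without the change of frame. *)
Definition pull_conn (i : 'I_n) (p : V) : 'M[R]_n := \sum_b J p i b *: A b (h p).

Lemma trilinear_sum (x y z : 'I_n -> R) (M : 'I_n -> 'M[R]_n) (Y Z : 'M[R]_n) i j :
  (forall a, Y i a = y a) -> (forall b, Z j b = z b) ->
  (Y *m (\sum_c x c *: M c) *m Z^T) i j =
  \sum_c \sum_a \sum_b x c * y a * z b * M c a b.
Proof.
move=> Yy Zz; rewrite mulmx_sumr mulmx_suml summxE; apply: eq_bigr => c _.
rewrite -scalemxAr -scalemxAl !mxE.
under eq_bigr do rewrite !mxE mulr_suml.
rewrite exchange_big mulr_sumr; apply: eq_bigr => a _.
rewrite mulr_sumr; apply: eq_bigr => b _.
by rewrite Yy Zz; ring.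
Qed.

Definition third_order (p : V) (l i j : 'I_n) : R :=
  \sum_c \sum_a \sum_b J p l c * J p i a * J p j b * mxpartial c g (h p) a b.

(** The derivative of the isometry equation J g(h) J^T = g. *)
Lemma metric_partial l i j p : U p ->
  mxpartial l g p i j =
  (mxpartial l J p *m g (h p) *m (J p)^T) i j
  + (mxpartial l J p *m g (h p) *m (J p)^T) j i + third_order p l i j.
Proof.
move=> Up; rewrite -(mxpartial_eq_on l oU Up h_isom).
have dJ := Jac_diff Up; have dg := g_diff (hU Up).
have dgh := mxdiff_comp (h_diff Up) dg.
rewrite mxpartialM; [|exact: mxdiffM|exact: mxdiff_tr].
rewrite mxpartialM// mxpartial_tr (@mxpartial_comp _ _ _ _ l h g); [|exact: h_diff|exact: dg].
have -> : \sum_c partial l (fun q => h q 0 c) p *: mxpartial c g (h p) =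
          \sum_c J p l c *: mxpartial c g (h p).
  by apply: eq_bigr => c _; rewrite JacE.
have S : (J p *m g (h p) *m (mxpartial l J p)^T) i j =
    (mxpartial l J p *m g (h p) *m (J p)^T) j i.
  have mxtr (M : 'M[R]_n) : M j i = M^T i j by rewrite mxE.
  rewrite [RHS]mxtr !trmx_mul trmxK.
  by rewrite g_sym ?mulmxA//; exact: hU.
rewrite mulmxDl mxE S [X in X + _ = _]mxE addrAC; congr (_ + _ + _).
exact: trilinear_sum.
Qed.

(** The combination of derivatives of g that defines the Christoffel symbols
    cancels all second derivatives of h in [metric_partial] except one. *)
Lemma christoffel1_transform l p : U p ->
  christoffel1 g l p = mxpartial l J p *m g (h p) *m (J p)^T
    + J p *m (\sum_c J p l c *: christoffel1 g c (h p)) *m (J p)^T.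
Proof.
move=> Up; apply/matrixP => i j.
pose Q (a b c : 'I_n) := (mxpartial a J p *m g (h p) *m (J p)^T) b c.
have Qsym a b c : Q a b c = Q b a c.
  rewrite /Q -!mulmxA !mxE; apply: eq_bigr => e _.
  by rewrite (Jac_partial_sym a b Up).
rewrite [in RHS]mxE [X in _ = _ + X](@trilinear_sum (J p l) (J p i) (J p j))//.
have -> : \sum_c \sum_a \sum_b J p l c * J p i a * J p j b * christoffel1 g c (h p) a b
  = (third_order p l i j + third_order p i l j - third_order p j l i) / 2.
  rewrite [X in _ = (_ + X - _) / 2](_ : _ = \sum_c \sum_a \sum_b
      J p l c * J p i a * J p j b * mxpartial a g (h p) c b); last first.
    rewrite /third_order exchange_big; apply: eq_bigr => c _; apply: eq_bigr => a _.
    by apply: eq_bigr => b _; congr (_ * _); ring.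
  rewrite [X in _ = (_ + _ - X) / 2](_ : _ = \sum_c \sum_a \sum_b
      J p l c * J p i a * J p j b * mxpartial b g (h p) c a); last first.
    rewrite /third_order exchange_big; apply: eq_bigr => c _.
    rewrite exchange_big; apply: eq_bigr => a _.
    by apply: eq_bigr => b _; congr (_ * _); ring.
  rewrite /third_order -big_split -sumrB mulr_suml; apply: eq_bigr => c _.
  rewrite -big_split -sumrB mulr_suml; apply: eq_bigr => a _.
  rewrite -big_split -sumrB mulr_suml; apply: eq_bigr => b _.
  by rewrite christoffel1E /=; field.
rewrite christoffel1E !metric_partial// -/(Q l i j) -/(Q l j i) -/(Q i l j) -/(Q i j l).
rewrite -/(Q j l i) -/(Q j i l) (Qsym i l) (Qsym j l) (Qsym j i).
by field.
Qed.

(** The transformation law of Christoffel symbols: the second derivatives of an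
    isometry are functions of its first ones. *)
Lemma Jac_partial l p : U p ->
  mxpartial l J p = A l p *m J p - J p *m pull_conn l p.
Proof.
move=> Up; have := christoffel1_transform l Up.
have -> : \sum_c J p l c *: christoffel1 g c (h p) = pull_conn l p *m g (h p).
  rewrite /pull_conn mulmx_suml; apply: eq_bigr => c _.
  by rewrite -scalemxAl A_lc//; exact: hU.
have uJT : (J p)^T \in unitmx by rewrite unitmx_tr Jac_unit.
have ug : g (h p) \in unitmx by apply: g_unit; exact: hU.
rewrite -A_lc// -(h_isom Up) !mulmxA -!mulmxDl => E.
by rewrite (mulmx_cancelr ug (mulmx_cancelr uJT E)) addrK.
Qed.

Lemma pull_conn_diff i p : U p -> mxdiff (pull_conn i) p.
Proof.
move=> Up; apply: (mxdiff_lincomb (x := fun b q => J q i b) (M := fun b q => A b (h q))).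
  by move=> b; exact: Jac_diff.
by move=> b; apply: mxdiff_comp; [exact: h_diff|exact: A_diff (hU Up)].
Qed.

Lemma pull_conn_partial l i p : U p ->
  mxpartial l (pull_conn i) p = \sum_b mxpartial l J p i b *: A b (h p)
    + \sum_b \sum_c (J p l c * J p i b) *: mxpartial c (A b) (h p).
Proof.
move=> Up.
rewrite (mxpartial_lincomb l (x := fun b q => J q i b) (M := fun b q => A b (h q))); first last.
- by move=> b; apply: mxdiff_comp; [exact: h_diff|exact: A_diff (hU Up)].
- by move=> b; exact: Jac_diff.
rewrite big_split /=; congr (_ + _); apply: eq_bigr => b _.
  by rewrite mxpartialE.
rewrite mxpartial_comp; [|exact: h_diff|exact: A_diff (hU Up)].
rewrite scaler_sumr; apply: eq_bigr => c _.
by rewrite scalerA mulrC (JacE h p l c).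
Qed.

Definition pull_curvature (l i : 'I_n) (p : V) : 'M[R]_n :=
  \sum_c \sum_b (J p l c * J p i b) *: curvature A c b (h p).

(** The second derivatives of h cancel because they are symmetric. *)
Lemma pull_conn_curvature l i p : U p ->
  mxpartial l (pull_conn i) p - mxpartial i (pull_conn l) p
  - pull_conn l p *m pull_conn i p + pull_conn i p *m pull_conn l p
  = pull_curvature l i p.
Proof.
move=> Up; rewrite !pull_conn_partial//.
have -> : \sum_b mxpartial i J p l b *: A b (h p) = \sum_b mxpartial l J p i b *: A b (h p).
  by apply: eq_bigr => b _; rewrite (Jac_partial_sym i l Up).
rewrite opprD addrACA subrr add0r.
have M x y : pull_conn x p *m pull_conn y p =
    \sum_c \sum_b (J p x c * J p y b) *: (A c (h p) *m A b (h p)).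
  rewrite /pull_conn mulmx_suml; apply: eq_bigr => c _.
  rewrite mulmx_sumr; apply: eq_bigr => b _.
  by rewrite -scalemxAl -scalemxAr scalerA.
rewrite [X in X - _ - _ + _]exchange_big /=.
rewrite !M [X in _ + X]exchange_big /= -!sumrB -big_split /=.
apply: eq_bigr => c _; rewrite -!sumrB -big_split /=; apply: eq_bigr => b _.
by rewrite [J p i b * _]mulrC /curvature !(scalerDr, scalerN).
Qed.

(** The integrability condition of the system [Jac_partial]: its terms without a
    curvature cancel when the two mixed derivatives of J are equated. *)
Lemma curvature_natural l i p : U p ->
  curvature A l i p *m J p = J p *m pull_curvature l i p.
Proof.
move=> Up; rewrite -pull_conn_curvature//.
have dJ := Jac_diff Up.
have D x y : mxpartial x (fun q => mxpartial y J q) p =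
   mxpartial x (A y) p *m J p + A y p *m (A x p *m J p - J p *m pull_conn x p)
   - ((A x p *m J p - J p *m pull_conn x p) *m pull_conn y p
      + J p *m mxpartial x (pull_conn y) p).
  rewrite (mxpartial_eq_on x oU Up (Jac_partial y)).
  have dA := A_diff y Up; have dB := pull_conn_diff y Up.
  rewrite mxpartialB; [|exact: mxdiffM|exact: mxdiffM].
  by rewrite mxpartialM// mxpartialM// !Jac_partial.
have S : mxpartial l (fun q => mxpartial i J q) p = mxpartial i (fun q => mxpartial l J q) p.
  apply/matrixP => a b; rewrite !mxpartialE.
  have E c : (fun q => mxpartial c J q a b) = partial c (partial a (fun q => h q 0 b)).
    by apply/funext => q; rewrite mxpartialE (Jac_entry a b).
  by rewrite (E i) (E l); exact: (partial_comm l i oU (diff_upto_partial a (h_diff3 b)) Up).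
move: S; rewrite !D /curvature; move: (mxpartial _ _ _) (mxpartial _ _ _).
move=> dAi dAl; move: (mxpartial _ _ _) (mxpartial _ _ _) => dBi dBl.
rewrite !(mulmxDl, mulmxDr, mulmxN, mulNmx, mulmxA) => /matrixP S.
have eD (M N : 'M[R]_n) a b : (M + N) a b = M a b + N a b by rewrite mxE.
have eN (M : 'M[R]_n) a b : (- M) a b = - M a b by rewrite mxE.
apply/matrixP => a b; have := S a b; rewrite !(eD, eN).
by lra.
Qed.

Lemma ricci_natural p : U p ->
  ricci A p = J p *m ricci A (h p) *m (J p)^T.
Proof.
move=> Up; have uJ := Jac_unit Up; apply/matrixP => i j; rewrite mxE.
have E l : curvature A l i p j l =
    \sum_c \sum_b J p l c * J p i b * (J p *m curvature A c b (h p) *m invmx (J p)) j l.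
  rewrite -[curvature A l i p](mulmxK uJ) curvature_natural// /pull_curvature.
  rewrite mulmx_sumr mulmx_suml summxE; apply: eq_bigr => c _.
  rewrite mulmx_sumr mulmx_suml summxE; apply: eq_bigr => b _.
  by rewrite -scalemxAr -scalemxAl mxE.
under eq_bigr => l _ do rewrite E.
rewrite exchange_big /=; under eq_bigr => c _ do rewrite exchange_big /=.
have F c b : \sum_l J p l c * J p i b * (J p *m curvature A c b (h p) *m invmx (J p)) j l
   = J p i b * (J p *m curvature A c b (h p)) j c.
  rewrite -[in RHS](mulmxKV uJ (J p *m _)) [in RHS]mxE mulr_sumr.
  by apply: eq_bigr => l _; ring.
under eq_bigr => c _ do under eq_bigr => b _ do rewrite F.
rewrite -mulmxA mxE exchange_big /=; apply: eq_bigr => b _.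
rewrite -mulr_sumr; congr (_ * _); rewrite [RHS]mxE.
under eq_bigr => c _ do rewrite mxE.
rewrite exchange_big /=; apply: eq_bigr => a _.
rewrite -mulr_sumr mulrC [in RHS]mxE; congr (_ * _).
by rewrite mxE.
Qed.

Theorem scalar_curvature_natural p : U p ->
  scalar_curvature g A (h p) = scalar_curvature g A p.
Proof.
move=> Up; have uJ := Jac_unit Up; have ug := g_unit (hU Up).
rewrite /scalar_curvature -(h_isom Up) (ricci_natural Up).
have uJT : (J p)^T \in unitmx by rewrite unitmx_tr.
have -> : invmx (J p *m g (h p) *m (J p)^T)
        = invmx (J p)^T *m invmx (g (h p)) *m invmx (J p).
  have uM : J p *m g (h p) *m (J p)^T \in unitmx by rewrite !unitmx_mul uJ ug.
  apply: (mulmx_cancelr uM); rewrite mulVmx// !mulmxA mulmxKV// mulmxKV//.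
  by rewrite mulVmx.
rewrite !mulmxA (mulmxKV uJ) [RHS]mxtrace_mulC !mulmxA (mulmxV uJT).
by rewrite mul1mx.
Qed.

End Curvature.

(** * Rational expressions in the coordinates *)

Section RationalExpr.
Context {R : realType}.
Local Notation V := 'rV[R]_4.

(** The metric, its connection and its Ricci tensor are rational in the
    coordinates. Their partial derivatives are computed on this syntax, which
    leaves identities between rational functions. *)
Inductive rexpr :=
  | RX | RY | RU | RV | RC of R
  | RAdd of rexpr & rexpr | RMul of rexpr & rexpr | ROpp of rexpr | RInv of rexpr.

Fixpoint reval (e : rexpr) (p : V) : R :=
  match e with
  | RX => p 0 0 | RY => p 0 1 | RU => p 0 2 | RV => p 0 3 | RC c => c
  | RAdd a b => reval a p + reval b p
  | RMul a b => reval a p * reval b p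
  | ROpp a => - reval a p
  | RInv a => (reval a p)^-1
  end.

Fixpoint rderiv (l : nat) (e : rexpr) : rexpr :=
  match e with
  | RX => RC (l == 0)%:R | RY => RC (l == 1)%:R | RU => RC (l == 2)%:R
  | RV => RC (l == 3)%:R | RC _ => RC 0
  | RAdd a b => RAdd (rderiv l a) (rderiv l b)
  | RMul a b => RAdd (RMul (rderiv l a) b) (RMul a (rderiv l b))
  | ROpp a => ROpp (rderiv l a)
  | RInv a => ROpp (RMul (rderiv l a) (RMul (RInv a) (RInv a)))
  end.

Fixpoint rdef (e : rexpr) (p : V) : Prop :=
  match e with
  | RAdd a b | RMul a b => rdef a p /\ rdef b p
  | ROpp a => rdef a p
  | RInv a => rdef a p /\ reval a p != 0
  | _ => True
  end.

Lemma partial_coord (l k : 'I_4) (p : V) : partial l (fun q => q 0 k) p = (l == k)%:R.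
Proof.
rewrite partialE; last exact: differentiable_coord.
by rewrite (@diff_entry _ _ _ _ id) // diff_val mxE eqxx eq_sym.
Qed.

Lemma reval_diff e p : rdef e p -> differentiable (reval e) p.
Proof.
elim: e => [|||| c | a IHa b IHb | a IHa b IHb | a IHa | a IHa] /=.
- by move=> _; exact: differentiable_coord.
- by move=> _; exact: differentiable_coord.
- by move=> _; exact: differentiable_coord.
- by move=> _; exact: differentiable_coord.
- by move=> _; exact: differentiable_cst.
- by move=> [da db]; apply: differentiableD; [exact: IHa|exact: IHb].
- by move=> [da db]; apply: differentiableM; [exact: IHa|exact: IHb].
- by move=> da; apply: differentiableN; exact: IHa.
- by move=> [da a0]; apply: differentiableV; [exact: IHa|].
Qed.

Lemma partialV n (F : 'rV[R]_n -> R) i p : differentiable F p -> F p != 0 ->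
  partial i (fun q => (F q)^-1) p = - (partial i F p * ((F p)^-1 * (F p)^-1)).
Proof.
move=> dF F0; rewrite partial.unlock (@deriveV _ _ F)//; last exact: diff_derivable.
by rewrite -[_ *: _]/(_ * _) expr2 invfM; ring.
Qed.

Lemma reval_partial (l : 'I_4) e p : rdef e p ->
  partial l (reval e) p = reval (rderiv l e) p.
Proof.
elim: e => [|||| c | a IHa b IHb | a IHa b IHb | a IHa | a IHa] /=.
- by rewrite partial_coord.
- by rewrite partial_coord.
- by rewrite partial_coord.
- by rewrite partial_coord.
- by rewrite partial_cst.
- by move=> [da db]; rewrite partialD ?IHa ?IHb//; exact: reval_diff.
- by move=> [da db]; rewrite partialM ?IHa ?IHb//; exact: reval_diff.
- by move=> da; rewrite partialN ?IHa//; exact: reval_diff.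
- by move=> [da a0]; rewrite partialV ?IHa//; exact: reval_diff.
Qed.

Definition rmx (rows : seq (seq rexpr)) (p : V) : 'M[R]_4 :=
  \matrix_(i < 4, j < 4) reval (nth (RC 0) (nth [::] rows i) j) p.

Definition rmxdef (rows : seq (seq rexpr)) (p : V) : Prop :=
  forall i j : 'I_4, rdef (nth (RC 0) (nth [::] rows i) j) p.

Lemma rmx_entry rows i j :
  (fun q => rmx rows q i j) = reval (nth (RC 0) (nth [::] rows i) j).
Proof. by apply/funext => q; rewrite mxE. Qed.

Lemma rmx_diff rows p : rmxdef rows p -> mxdiff (rmx rows) p.
Proof. by move=> d i j; rewrite rmx_entry; exact: reval_diff. Qed.

Lemma rmx_partial rows l p i j : rmxdef rows p ->
  mxpartial l (rmx rows) p i j = reval (rderiv l (nth (RC 0) (nth [::] rows i) j)) p.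
Proof. by move=> d; rewrite mxpartialE rmx_entry reval_partial. Qed.

End RationalExpr.
Arguments RX {R}. Arguments RY {R}. Arguments RU {R}. Arguments RV {R}.

(** * Connection and curvature of the metric *)

Section Metric.
Context {R : realType} (k : R) (k_gt0 : 0 < k).
Local Notation V := 'rV[R]_4.
Local Notation g := (neutral_metric (fun t : R => - k * t)).
Local Notation c := (@RC R).
Local Notation "a ⊕ b" := (RAdd a b) (at level 50, left associativity).
Local Notation "a ⊗ b" := (RMul a b) (at level 40, left associativity).

Definition eR2 := RU ⊗ RU ⊕ RV ⊗ RV : @rexpr R.
Definition eT := c k ⊗ (RY ⊗ RY ⊗ RY) ⊗ eR2.
Definition eD := c 1 ⊕ eT.

Definition metric_rows : seq (seq (@rexpr R)) :=
  let a := RInv (RY ⊗ RY) ⊕ c (- 2 * k) ⊗ RY ⊗ eR2 in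
  let b := c (- (4 / 3) * k) ⊗ (RY ⊗ RY ⊗ RY) in
  let cc := c (- 2 * k) ⊗ RV ⊗ (RY ⊗ RY) in
  let d := c (- 2 * k) ⊗ RU ⊗ (RY ⊗ RY) in
  [:: [:: a; c 0; cc; ROpp d]; [:: c 0; a; d; cc]; [:: cc; d; b; c 0];
      [:: ROpp d; cc; c 0; b]].

(** The metric is pseudo-Kaehler for (z, w): its Christoffel symbols are those of
    the Hermitian matrix with rows (y^-2 - 2 k y |w|^2, 2 i k y^2 w) and
    (- 2 i k y^2 conj w, - 4/3 k y^3). So each of the four matrices is the real
    form of a complex 2 x 2 matrix, with entries on the lines of i al, be w,
    ga conj w and i de, and the one of y (of v) is i times the one of x (of u). *)
Definition connection_rows (l : nat) : seq (seq (@rexpr R)) :=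
  let al := (c 1 ⊕ c (-2) ⊗ eT) ⊗ RInv RY ⊗ RInv eD in
  let be := c (- (3 / 2)) ⊗ (c 2 ⊕ ROpp eT) ⊗ RInv (RY ⊗ RY) ⊗ RInv eD in
  let ga := c k ⊗ (RY ⊗ RY ⊗ RY) ⊗ RInv eD in
  let de := c (- (3 / 2)) ⊗ RInv RY ⊗ RInv eD in
  let zw := [:: ga ⊗ RU; ROpp (ga ⊗ RV); c 0; de] in
  let izw := [:: ga ⊗ RV; ga ⊗ RU; ROpp de; c 0] in
  let iizw := [:: ROpp (ga ⊗ RU); ga ⊗ RV; c 0; ROpp de] in
  match l with
  | 0 => [:: [:: c 0; al; be ⊗ RU; be ⊗ RV]; [:: ROpp al; c 0; ROpp (be ⊗ RV); be ⊗ RU];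
             zw; izw]
  | 1 => [:: [:: ROpp al; c 0; ROpp (be ⊗ RV); be ⊗ RU];
             [:: c 0; ROpp al; ROpp (be ⊗ RU); ROpp (be ⊗ RV)]; izw; iizw]
  | 2 => [:: zw; izw]
  | _ => [:: izw; iizw]
  end.

Definition connection (l : 'I_4) := rmx (connection_rows l).

Lemma metricE (p : V) : p 0 1 != 0 -> g p = rmx metric_rows p.
Proof.
move=> y0; apply/matrixP => i j; rewrite !mxE.
have -> t : derive1 (fun t : R => - k * t) t = - k.
  by rewrite derive1E deriveMl// derive_id mulr1.
case: i => [[|[|[|[|//]]]] hi]; case: j => [[|[|[|[|//]]]] hj] //=; by field.
Qed.

Lemma H2C_open : open (H2C R).
Proof.
rewrite (_ : H2C R = (fun p : V => p 0 1) @^-1` [set y : R | 0 < y]); last by [].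
by apply: open_comp; [move=> p _; exact: coord_continuous|exact: open_gt].
Qed.

Lemma H2C_y (p : V) : H2C R p -> 0 < p 0 1.
Proof. by []. Qed.

Lemma eT_ge0 p : H2C R p -> 0 <= reval eT p.
Proof.
move=> /H2C_y y0 /=; rewrite mulr_ge0 ?addr_ge0 -?expr2 ?sqr_ge0//.
by rewrite mulr_ge0 ?mulr_ge0 ?ltW// exprn_gt0.
Qed.

Lemma eD_gt0 p : H2C R p -> 0 < reval eD p.
Proof. by move=> Hp; rewrite ltr_wpDr// eT_ge0. Qed.

Lemma metric_rows_def p : H2C R p -> rmxdef metric_rows p.
Proof.
move=> /H2C_y y0 i j; have := lt0r_neq0 y0 => yn.
by case: i => [[|[|[|[|//]]]] hi]; case: j => [[|[|[|[|//]]]] hj] /=;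
  rewrite ?mulf_neq0.
Qed.

Lemma connection_def l p : H2C R p -> rmxdef (connection_rows l) p.
Proof.
move=> Hp i j; have := lt0r_neq0 (H2C_y Hp) => yn; have /= Dn := lt0r_neq0 (eD_gt0 Hp).
by case: l => [|[|[|l]]]; case: i => [[|[|[|[|//]]]] hi]; case: j => [[|[|[|[|//]]]] hj] /=;
  rewrite ?mulf_neq0.
Qed.

End Metric.

Section CurvatureOfMetric.
Context {R : realType} (k : R) (k_gt0 : 0 < k).
Local Notation V := 'rV[R]_4.
Local Notation G := (rmx (metric_rows k)).
Local Notation A := (connection k).

Lemma sum_ord4 (F : 'I_4 -> R) :
  \sum_i F i = F 0 + F 1 + F 2 + F 3.
Proof.
rewrite !big_ord_recr big_ord0 /= add0r.
by congr (F _ + F _ + F _ + F _); apply: val_inj.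
Qed.

Lemma mulmx4E (M N : 'M[R]_4) a b : (M *m N) a b =
  M a 0 * N 0 b + M a 1 * N 1 b + M a 2 * N 2 b + M a 3 * N 3 b.
Proof. by rewrite mxE sum_ord4. Qed.

Lemma connection_lc p l : H2C R p -> A l p *m G p = christoffel1 G l p.
Proof.
move=> Hp; have yn := lt0r_neq0 (H2C_y Hp); have /= Dn := lt0r_neq0 (eD_gt0 k_gt0 Hp).
have Gd := metric_rows_def k Hp.
apply/matrixP => i j; rewrite christoffel1E !rmx_partial//.
rewrite mxE sum_ord4 !mxE.
case: l => [[|[|[|[|//]]]] hl]; case: i => [[|[|[|[|//]]]] hi];
  case: j => [[|[|[|[|//]]]] hj]; rewrite /=.
all: by field; rewrite ?yn ?Dn.
Qed.

Local Notation c := (@RC R).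
Local Notation "a ⊕ b" := (RAdd a b) (at level 50, left associativity).
Local Notation "a ⊗ b" := (RMul a b) (at level 40, left associativity).

(** The real form of the complex Hessian - 2 ddbar log (y D) with D = 1 + k t, as
    y D is up to a constant the determinant of the Hermitian matrix of the
    metric. *)
Definition ricci_rows : seq (seq (@rexpr R)) :=
  let iDD := RInv (@eD R k ⊗ @eD R k) in
  let s := c 1 ⊕ c (-2) ⊗ eT k in
  let a := c (1 / 2) ⊗ s ⊗ s ⊗ RInv (RY ⊗ RY) ⊗ iDD in
  let b := c (- 2 * k) ⊗ (RY ⊗ RY ⊗ RY) ⊗ iDD in
  let cc := c (- 3 * k) ⊗ RV ⊗ (RY ⊗ RY) ⊗ iDD in
  let d := c (- 3 * k) ⊗ RU ⊗ (RY ⊗ RY) ⊗ iDD in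
  [:: [:: a; c 0; cc; ROpp d]; [:: c 0; a; d; cc]; [:: cc; d; b; c 0];
      [:: ROpp d; cc; c 0; b]].

Lemma connection_ricci p : H2C R p -> ricci A p = rmx ricci_rows p.
Proof.
move=> Hp; have yn := lt0r_neq0 (H2C_y Hp); have /= Dn := lt0r_neq0 (eD_gt0 k_gt0 Hp).
have Ad l := connection_def k_gt0 l Hp.
have eD4 (M N P Q : 'M[R]_4) a b : (M - N - P + Q) a b = M a b - N a b - P a b + Q a b.
  by rewrite !mxE.
apply/matrixP => i j; rewrite [LHS]mxE sum_ord4 /curvature !eD4.
rewrite !rmx_partial//.
rewrite !mulmx4E !mxE.
case: i => [[|[|[|[|//]]]] hi]; case: j => [[|[|[|[|//]]]] hj]; rewrite /=.
all: by field; rewrite ?yn ?Dn.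
Qed.

Definition cometric_rows : seq (seq (@rexpr R)) :=
  let i := RInv (c (- (4 / 3) * k) ⊗ RY ⊗ eD k) in
  let a := (RInv (RY ⊗ RY) ⊕ c (- 2 * k) ⊗ RY ⊗ eR2) ⊗ i in
  let b := c (- (4 / 3) * k) ⊗ (RY ⊗ RY ⊗ RY) ⊗ i in
  let cc := c (2 * k) ⊗ RV ⊗ (RY ⊗ RY) ⊗ i in
  let d := c (2 * k) ⊗ RU ⊗ (RY ⊗ RY) ⊗ i in
  [:: [:: b; c 0; cc; ROpp d]; [:: c 0; b; d; cc]; [:: cc; d; a; c 0];
      [:: ROpp d; cc; c 0; a]].

Lemma cometricP p : H2C R p -> rmx cometric_rows p *m G p = 1%:M.
Proof.
move=> Hp; have yn := lt0r_neq0 (H2C_y Hp); have /= Dn := lt0r_neq0 (eD_gt0 k_gt0 Hp).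
have kn := lt0r_neq0 k_gt0.
apply/matrixP => i j; rewrite mxE sum_ord4 !mxE.
case: i => [[|[|[|[|//]]]] hi]; case: j => [[|[|[|[|//]]]] hj]; rewrite /=.
all: by field; rewrite ?yn ?Dn ?kn.
Qed.

Lemma metric_unit p : H2C R p -> G p \in unitmx.
Proof. by move=> /cometricP/mulmx1_unit[]. Qed.

Lemma metric_rows_sym p : (G p)^T = G p.
Proof.
apply/matrixP => i j; rewrite !mxE.
by case: i => [[|[|[|[|//]]]] hi]; case: j => [[|[|[|[|//]]]] hj].
Qed.

(** Injective as a function of t = y^3 |w|^2, which is what is needed of it. *)
Lemma scalar_curvatureE p : H2C R p ->
  scalar_curvature G A p = 4 / (1 + k * (p 0 1 ^+ 3 * (p 0 2 ^+ 2 + p 0 3 ^+ 2))).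
Proof.
move=> Hp; have yn := lt0r_neq0 (H2C_y Hp); have /= Dn := lt0r_neq0 (eD_gt0 k_gt0 Hp).
have kn := lt0r_neq0 k_gt0.
have -> : 1 + k * (p 0 1 ^+ 3 * (p 0 2 ^+ 2 + p 0 3 ^+ 2)) = reval (eD k) p by rewrite /=; ring.
have Gi : invmx (G p) = rmx cometric_rows p.
  by apply: (mulmx_cancelr (metric_unit Hp)); rewrite cometricP// mulVmx// metric_unit.
rewrite /scalar_curvature Gi connection_ricci//
  /mxtrace sum_ord4 ![(_ *m _) _ _]mxE !sum_ord4 !mxE /=.
by field; rewrite ?yn ?Dn ?kn.
Qed.

(** The scalar curvature is preserved and determines y^3 |w|^2. *)
Lemma fibre_norm_preserved (h : V -> V) :
  (forall p, H2C R p -> H2C R (h p)) ->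
  (forall p, H2C R p -> differentiable h p) ->
  (forall j, diff_upto 3 (H2C R) (fun q => h q 0 j)) ->
  (forall p, H2C R p -> Jac h p *m G (h p) *m (Jac h p)^T = G p) ->
  forall p, H2C R p ->
  h p 0 1 ^+ 3 * (h p 0 2 ^+ 2 + h p 0 3 ^+ 2) = p 0 1 ^+ 3 * (p 0 2 ^+ 2 + p 0 3 ^+ 2).
Proof.
move=> hU hd h3 hi p Hp.
have oU := @H2C_open R.
have E : 4 / (1 + k * (h p 0 1 ^+ 3 * (h p 0 2 ^+ 2 + h p 0 3 ^+ 2)))
       = 4 / (1 + k * (p 0 1 ^+ 3 * (p 0 2 ^+ 2 + p 0 3 ^+ 2))).
  rewrite -!scalar_curvatureE//; last exact: hU.
  apply: (scalar_curvature_natural (U := H2C R)) => //.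
  - by move=> q Hq; exact: rmx_diff (metric_rows_def k Hq).
  - by move=> q Hq; exact: metric_rows_sym.
  - exact: metric_unit.
  - by move=> q l Hq; exact: rmx_diff (connection_def k_gt0 l Hq).
  - by move=> q l Hq; exact: connection_lc.
have n4 : (4 : R) != 0 by [].
by move/(mulfI n4)/invr_inj/addrI/(mulfI (lt0r_neq0 k_gt0)) : E.
Qed.
End CurvatureOfMetric.

(** * Isometries are bundle maps, linear on fibres *)

Section LimitLemma.
Context {R : realType}.

(** The derivative at 0 is a limit, and difference quotients on the right are
    constant. *)
Lemma derive0_of_right_linear (f : R -> R) (c L : R) :
  is_derive (0 : R) 1 f L -> f 0 = 0 -> (forall s, 0 < s <= 1 -> f s = s * c) -> L = c.
Proof.
move=> [df fL] f0 fs; apply/eqP; rewrite -subr_eq0 -normr_le0.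
apply/ler_addgt0Pr => e e0; rewrite add0r.
move: df; rewrite /derivable => /cvg_ex[l /= cl].
have -> : L = l by rewrite -fL; apply/cvg_lim.
move/cvgrPdist_lt : cl => /(_ e e0) /nbhs_ballP[r /= r0 Hr].
pose s := Num.min (r / 2) 1.
have s0 : 0 < s by rewrite lt_min divr_gt0 //=.
have s1 : s <= 1 by rewrite ge_min lexx orbT.
have sr : s < r.
  by rewrite (@le_lt_trans _ _ (r / 2)) ?ge_min ?lexx// ltr_pdivrMr// ltr_pMr// ltr1n.
have /Hr : ball 0 r s by rewrite -ball_normE /ball_ /= sub0r normrN gtr0_norm.
move=> /(_ (lt0r_neq0 s0)); rewrite /= addr0 f0 subr0 [_ *: 1]mulr1 fs ?s0//.
by rewrite -[_ *: _]/(_ * _) mulKf ?gt_eqF// => /ltW.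
Qed.

End LimitLemma.

Section Bundle.
Context {R : realType} (k : R) (k_gt0 : 0 < k).
Local Notation V := 'rV[R]_4.
Local Notation G := (rmx (metric_rows k)).
Local Notation H := (H2C R).

(** What the proof uses of an isometry. The order 3 is the one for which
    [partial_comm] applies to the first derivatives of h, as the curvature asks. *)
Definition chart_isometry (h : V -> V) : Prop :=
  [/\ forall p, H p -> H (h p), forall p, H p -> differentiable h p,
      forall j, diff_upto 3 H (fun q => h q 0 j) &
      forall p, H p -> Jac h p *m G (h p) *m (Jac h p)^T = G p].

Context (h : V -> V) (hI : chart_isometry h).
Local Notation J := (Jac h).

Lemma iso_H p : H p -> H (h p). Proof. by case: hI => + _ _ _; apply. Qed.
Lemma iso_diff p : H p -> differentiable h p.
Proof. by case: hI => _ + _ _; apply. Qed.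
Lemma iso_metric p : H p -> J p *m G (h p) *m (J p)^T = G p.
Proof. by case: hI => _ _ _; apply. Qed.
Lemma iso_Jac_diff p i j : H p -> differentiable (fun q => J q i j) p.
Proof.
case: hI => _ _ h3 _ Hp.
have -> : (fun q => J q i j) = partial i (fun q => h q 0 j).
  by apply/funext => q; rewrite JacE.
exact: (diff_upto_differentiable (diff_upto_partial i (h3 j)) Hp).
Qed.
Lemma iso_Jac_unit p : H p -> J p \in unitmx.
Proof.
move=> Hp; have := metric_unit k_gt0 Hp; rewrite -(iso_metric Hp) !unitmxE !det_mulmx.
by rewrite !unitrM => /andP[/andP[]].
Qed.

Lemma iso_tau p : H p ->
  h p 0 1 ^+ 3 * (h p 0 2 ^+ 2 + h p 0 3 ^+ 2) = p 0 1 ^+ 3 * (p 0 2 ^+ 2 + p 0 3 ^+ 2).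
Proof. by case: hI => hU hd h3 hi; exact: (fibre_norm_preserved k_gt0). Qed.

Definition euler (p : V) : V := \row_j nth 0 [:: 0; 0; p 0 2; p 0 3] j.

Definition etau : @rexpr R := RMul (RMul RY (RMul RY RY)) eR2.

Lemma etauE p : reval etau p = p 0 1 ^+ 3 * (p 0 2 ^+ 2 + p 0 3 ^+ 2).
Proof. by rewrite /=; ring. Qed.

Definition grad_tau (p : V) : 'cV[R]_4 := \col_i partial i (reval etau) p.

(** The Euler field is vertical and vertical vectors are orthogonal to the kernel
    of dw - (3/2) i w dz / y, so only the derivative of t along the fibre counts. *)
Lemma euler_grad p : H p -> euler p *m G p = - (2 / 3 * k) *: (grad_tau p)^T.
Proof.
move=> /H2C_y/lt0r_neq0 yn; apply/matrixP => i j; rewrite ord1 mxE sum_ord4 !mxE reval_partial//=.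
by case: j => [[|[|[|[|//]]]] hj] /=; field; rewrite ?yn.
Qed.

Lemma grad_tau_natural p : H p -> grad_tau p = J p *m grad_tau (h p).
Proof.
move=> Hp; apply/matrixP => i j; rewrite !mxE.
rewrite (partial_eq_on i (@H2C_open R) Hp (G := fun q => reval etau (h q))); last first.
  by move=> q Hq; rewrite !etauE iso_tau.
rewrite partial_comp; [|exact: iso_diff|exact: reval_diff].
by apply: eq_bigr => b _; rewrite JacE !mxE.
Qed.

(** By [euler_grad] the Euler field of the fibres is a constant multiple of the
    gradient of the fibre norm, which h preserves together with the metric. *)
Lemma euler_natural p : H p -> euler p *m J p = euler (h p).
Proof.
move=> Hp; have uJT : (J p)^T \in unitmx by rewrite unitmx_tr iso_Jac_unit.
apply: (mulmx_cancelr (metric_unit k_gt0 (iso_H Hp))).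
apply: (mulmx_cancelr uJT).
rewrite -[LHS]mulmxA -[LHS]mulmxA [X in euler p *m X](mulmxA _ (G (h p))).
rewrite (iso_metric Hp).
rewrite (euler_grad Hp).
rewrite (euler_grad (iso_H Hp)).
rewrite (grad_tau_natural Hp) trmx_mul -scalemxAl.
by [].
Qed.

Definition pt (x y u v : R) : V := \row_j nth 0 [:: x; y; u; v] j.

Lemma pt0 x y u v : pt x y u v 0 0 = x. Proof. by rewrite mxE. Qed.
Lemma pt1 x y u v : pt x y u v 0 1 = y. Proof. by rewrite mxE. Qed.
Lemma pt2 x y u v : pt x y u v 0 2 = u. Proof. by rewrite mxE. Qed.
Lemma pt3 x y u v : pt x y u v 0 3 = v. Proof. by rewrite mxE. Qed.
Definition ptE := (pt0, pt1, pt2, pt3).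

Lemma row4P (p q : V) : p 0 0 = q 0 0 -> p 0 1 = q 0 1 -> p 0 2 = q 0 2 -> p 0 3 = q 0 3 ->
  p = q.
Proof.
move=> e0 e1 e2 e3; apply/rowP => i; case: i => [[|[|[|[|//]]]] hi].
- by rewrite (_ : Ordinal hi = 0)//; exact: val_inj.
- by rewrite (_ : Ordinal hi = 1)//; exact: val_inj.
- by rewrite (_ : Ordinal hi = 2)//; exact: val_inj.
- by rewrite (_ : Ordinal hi = 3)//; exact: val_inj.
Qed.

Lemma ptK (p : V) : pt (p 0 0) (p 0 1) (p 0 2) (p 0 3) = p.
Proof. by apply: row4P; rewrite !ptE. Qed.

Lemma H_pt x y u v : H (pt x y u v) = (0 < y) :> Prop.
Proof. by rewrite /H2C /= ptE. Qed.

Lemma ptD x y u v (w : V) s :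
  pt x y u v + s *: w = pt (x + s * w 0 0) (y + s * w 0 1) (u + s * w 0 2) (v + s * w 0 3).
Proof. by apply: row4P; rewrite !mxE. Qed.

Lemma Jac_line p (w : V) j : H p ->
  'D_w (fun q => h q 0 j) p = (w *m J p) 0 j.
Proof.
move=> Hp; rewrite derive_partial; last exact: (differentiable_entry 0 j (iso_diff Hp)).
by rewrite [RHS]mxE; apply: eq_bigr => i _; rewrite JacE.
Qed.

Lemma ray_derive x y u v (s : R) j : 0 < y ->
  is_derive s 1 (fun s => h (pt x y (s * u) (s * v)) 0 j)
    ((pt 0 0 u v *m J (pt x y (s * u) (s * v))) 0 j).
Proof.
move=> y0; set w := pt 0 0 u v.
have E t : pt x y (t * u) (t * v) = pt x y 0 0 + t *: w.
  by rewrite ptD !ptE !mulr0 !addr0 !add0r.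
have -> : (fun s => h (pt x y (s * u) (s * v)) 0 j) =
          (fun s => h (pt x y 0 0 + s *: w) 0 j).
  by apply/funext => t; rewrite E.
have Hs : H (pt x y 0 0 + s *: w) by rewrite -E H_pt.
rewrite E -Jac_line//; apply: (is_derive_line (F := fun q => h q 0 j)).
exact/diff_derivable/(differentiable_entry 0 j (iso_diff Hs)).
Qed.

(** The Euler field at (z, s w) is s times the vector w, so that its preservation
    is an ordinary differential equation along each ray of a fibre. *)
Lemma ray_euler x y u v s j : 0 < y ->
  s * (pt 0 0 u v *m J (pt x y (s * u) (s * v))) 0 j
  = euler (h (pt x y (s * u) (s * v))) 0 j.
Proof.
move=> y0; rewrite -euler_natural ?H_pt//.
have -> : euler (pt x y (s * u) (s * v)) = s *: pt 0 0 u v.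
  by apply: row4P; rewrite !mxE /= ?mulr0.
by rewrite -scalemxAl [in RHS]mxE.
Qed.

(** The components of the Euler field along the base vanish, so those of h are
    constant along rays, down to the origin of the fibre by continuity. *)
Lemma fibre_const x y u v (j : 'I_4) : 0 < y -> (j < 2)%N ->
  h (pt x y u v) 0 j = h (pt x y 0 0) 0 j.
Proof.
move=> y0 j2; pose f (s : R) := h (pt x y (s * u) (s * v)) 0 j.
have fD (s : R) : 0 < s -> is_derive s 1 f 0.
  move=> s0; have := @ray_derive x y u v s j y0.
  have := @ray_euler x y u v s j y0; rewrite [X in _ = X]mxE.
  have -> : nth 0 [:: 0; 0; h (pt x y (s * u) (s * v)) 0 2;
     h (pt x y (s * u) (s * v)) 0 3] j = 0 by case: j j2 {f} => [[|[|]]].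
  by move/eqP; rewrite mulf_eq0 gt_eqF//= => /eqP ->.
have [| |s _] := @MVT _ f (fun=> 0) 0 1 ltr01.
- by move=> s; rewrite in_itv /= => /andP[s0 _]; exact: fD.
- apply: continuous_subspaceT => s.
  by apply/differentiable_continuous/derivable1_diffP; case: (@ray_derive x y u v s j y0).
by rewrite /f !mul0r !mul1r => /eqP; rewrite subr_eq0 => /eqP.
Qed.

(** The zero section is the set where the fibre norm vanishes. *)
Lemma zero_section x y : 0 < y ->
  h (pt x y 0 0) 0 2 = 0 /\ h (pt x y 0 0) 0 3 = 0.
Proof.
move=> y0; have Hp : H (pt x y 0 0) by rewrite H_pt.
have := iso_tau Hp; rewrite !ptE !expr0n /= addr0 mulr0 => /eqP.
have /H2C_y Y0 := iso_H Hp.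
rewrite mulf_eq0 expf_eq0 /= gt_eqF//= paddr_eq0 ?sqr_ge0// !sqrf_eq0.
by move=> /andP[/eqP -> /eqP ->].
Qed.

(** A component of h along the fibre, restricted to a ray, satisfies s f' = f.
    Hence it is linear for s > 0, with slope its derivative at the origin, which
    is linear in the direction of the ray. *)
Lemma fibre_linear x y u v (j : 'I_4) : 0 < y -> (2 <= j)%N ->
  h (pt x y u v) 0 j = u * J (pt x y 0 0) 2 j + v * J (pt x y 0 0) 3 j.
Proof.
move=> y0 j2; pose f (s : R) := h (pt x y (s * u) (s * v)) 0 j.
pose f' (s : R) := (pt 0 0 u v *m J (pt x y (s * u) (s * v))) 0 j.
have fD (s : R) : is_derive s 1 f (f' s) by exact: ray_derive.
have ff' s : s * f' s = f s.
  rewrite /f' ray_euler// [LHS]mxE /f.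
  case: j j2 {f f' fD} => [[|[|[|[|//]]]] hj] //= _;
  by congr (h _ _ _); exact: val_inj.
have f0 : f 0 = 0 by rewrite -ff' mul0r.
have L : f' 0 = f 1.
  apply: derive0_of_right_linear (fD 0) f0 _ => s /andP[s0 s1].
  pose g (t : R) := f t * t^-1.
  have gD (t : R) : s <= t -> is_derive t 1 g 0.
    move=> st; have t0 : t != 0 by rewrite gt_eqF// (lt_le_trans s0 st).
    have dV : is_derive t 1 (fun t : R => t^-1) (- (t^-1 * t^-1)).
      apply: DeriveDef; first exact: derivableV.
      rewrite (@deriveV _ _ (fun t => t))// derive_id -[_ *: _]/(_ * _) mulr1.
      by rewrite expr2 invfM.
    have := is_deriveM (fD t) dV; rewrite -![_ *: _]/(_ * _) -ff'.
    by move=> d; apply: is_derive_eq d _; field.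
  have [| |t _] := @MVT_segment _ g (fun=> 0) s 1 s1.
  - by move=> t; rewrite in_itv /= => /andP[/ltW st _]; exact: gD.
  - apply: continuous_in_subspaceT => t; rewrite inE /= in_itv /= => /andP[st _].
    by apply/differentiable_continuous/derivable1_diffP; case: (gD t st).
  rewrite /g invr1 mulr1 mul0r => /eqP; rewrite subr_eq0 => /eqP ->.
  by rewrite mulrC divfK ?gt_eqF.
move: L; rewrite /f /f' !mul0r !mul1r => <-.
by rewrite mxE sum_ord4 !ptE !mul0r !add0r.
Qed.

End Bundle.

(** * Linear forms of the hyperboloid model *)

Section Slices.
Context {R : realType}.
Local Notation V := 'rV[R]_4.

Lemma slice_const (F : V -> R) (u v : R) :
  (forall x y, 0 < y -> [/\ differentiable F (pt x y u v),
     partial 0 F (pt x y u v) = 0 & partial 1 F (pt x y u v) = 0]) ->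
  forall x y x' y', 0 < y -> 0 < y' -> F (pt x y u v) = F (pt x' y' u v).
Proof.
move=> FP x y x' y' y0 y'0; apply: segment_const => s /andP[s0 s1].
have E : pt x y u v + s *: (pt x' y' u v - pt x y u v) =
         pt (x + s * (x' - x)) (y + s * (y' - y)) u v.
  by apply: row4P; rewrite !mxE /= ?subrr ?mulr0 ?addr0.
have ys : 0 < y + s * (y' - y).
  have -> : y + s * (y' - y) = (1 - s) * y + s * y' by ring.
  have [->|sn0] := eqVneq s 0; first by rewrite subr0 mul1r mul0r addr0.
  by rewrite ltr_wpDl ?mulr_ge0 ?subr_ge0 ?(ltW y0)// mulr_gt0// lt_def sn0.
have [dF F0 F1] := FP (x + s * (x' - x)) _ ys.
rewrite E derive_partial// sum_ord4 F0 F1 !mxE /= !subrr !mulr0 !mul0r !addr0.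
by split.
Qed.

(** The first integrals below are all of this form: unknown functions with
    explicit coefficients. *)
Definition comb3 (f f1 f2 : V -> R) (e e1 e2 : @rexpr R) (q : V) : R :=
  f q * reval e q + f1 q * reval e1 q + f2 q * reval e2 q.

Lemma comb3_partial f f1 f2 e e1 e2 p (l : 'I_4) :
  differentiable f p -> differentiable f1 p -> differentiable f2 p ->
  rdef e p -> rdef e1 p -> rdef e2 p ->
  differentiable (comb3 f f1 f2 e e1 e2) p /\
  partial l (comb3 f f1 f2 e e1 e2) p =
    partial l f p * reval e p + f p * reval (rderiv l e) p
    + (partial l f1 p * reval e1 p + f1 p * reval (rderiv l e1) p)
    + (partial l f2 p * reval e2 p + f2 p * reval (rderiv l e2) p).
Proof.
move=> df df1 df2 /[dup] de /reval_diff re /[dup] de1 /reval_diff re1.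
move=> /[dup] de2 /reval_diff re2.
have dm := differentiableM df re; have dm1 := differentiableM df1 re1.
have dm2 := differentiableM df2 re2.
split; first exact: differentiableD (differentiableD dm dm1) dm2.
rewrite (partialD l (differentiableD dm dm1) dm2) (partialD l dm dm1).
by rewrite !partialM// !reval_partial.
Qed.

(** The hypotheses say that f1 and f2 are the derivatives of f along the frame
    (y d/dx, y d/dy) and that the Hessian of f is f times the hyperbolic metric.
    The solutions are the linear forms of the hyperboloid model, combinations of
    1/y, x/y and (x^2 + y^2)/y: the three coefficients, expressed by f, f1, f2,
    have zero derivatives, hence equal their values at (0, 1). *)
Lemma hyperbolic_hessian (f f1 f2 : V -> R) :
  (forall x y, 0 < y -> let p := pt x y 0 0 in
     [/\ differentiable f p, differentiable f1 p & differentiable f2 p] /\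
     [/\ y * partial 0 f p = f1 p, y * partial 1 f p = f2 p,
         y * partial 0 f1 p = f p + f2 p & y * partial 1 f1 p = 0] /\
     y * partial 0 f2 p = - f1 p /\ y * partial 1 f2 p = f p) ->
  let o := pt 0 1 0 0 in
  forall x y, 0 < y -> f (pt x y 0 0) =
    ((f o - f2 o) / 2 + f1 o * x + (f o + f2 o) / 2 * (x ^+ 2 + y ^+ 2)) / y.
Proof.
move=> Hf o x y y0.
pose iY := @RInv R RY; pose h2 := @RC R (1 / 2).
pose ga : @rexpr R := RMul h2 iY.
pose be : @rexpr R := ROpp (RMul RX iY).
pose al : @rexpr R := RMul (RAdd (RMul RX RX) (ROpp (RMul RY RY))) (RMul h2 iY).
pose Ga := comb3 f f1 f2 ga (RC 0) ga.
pose Be := comb3 f f1 f2 be (RC 1) be.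
pose Al := comb3 f f1 f2 (RAdd RY al) (ROpp RX) al.
have K (e e1 e2 : @rexpr R) :
    (forall x y, 0 < y -> let p := pt x y 0 0 in
       [/\ rdef e p, rdef e1 p & rdef e2 p]) ->
    (forall x y (c c1 c2 : R), 0 < y -> let p := pt x y 0 0 in
       c1 / y * reval e p + c * reval (rderiv 0 e) p
       + ((c + c2) / y * reval e1 p + c1 * reval (rderiv 0 e1) p)
       + (- c1 / y * reval e2 p + c2 * reval (rderiv 0 e2) p) = 0 /\
       c2 / y * reval e p + c * reval (rderiv 1 e) p
       + (0 * reval e1 p + c1 * reval (rderiv 1 e1) p)
       + (c / y * reval e2 p + c2 * reval (rderiv 1 e2) p) = 0) ->
    comb3 f f1 f2 e e1 e2 (pt x y 0 0) = comb3 f f1 f2 e e1 e2 o.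
  move=> de E; apply: slice_const => // x' y' y'0.
  have [[df df1 df2] [[a0 a1 b0 b1] [c0 c1]]] := Hf x' y' y'0.
  have [d d1 d2] := de x' y' y'0.
  have [dc p0] := comb3_partial 0 df df1 df2 d d1 d2.
  have [_ p1] := comb3_partial 1 df df1 df2 d d1 d2.
  have S (a b : R) : y' * a = b -> a = b / y'.
    by move=> <-; rewrite mulrC mulKf// gt_eqF.
  have [E0 E1] := E x' y' (f (pt x' y' 0 0)) (f1 (pt x' y' 0 0)) (f2 (pt x' y' 0 0)) y'0.
  split=> //.
    by rewrite p0 (S _ _ a0) (S _ _ b0) (S _ _ c0) -[RHS]E0.
  by rewrite p1 (S _ _ a1) (S _ _ b1) (S _ _ c1) mul0r -[RHS]E1.
have yn : y != 0 by rewrite gt_eqF.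
have EG : Ga (pt x y 0 0) = Ga o.
  apply: K => x' y' ; last move=> c c1 c2; move=> y'0 p; have y'n : y' != 0 by rewrite gt_eqF.
    by rewrite /= !ptE.
  by split; rewrite /= !ptE; field.
have EB : Be (pt x y 0 0) = Be o.
  apply: K => x' y' ; last move=> c c1 c2; move=> y'0 p; have y'n : y' != 0 by rewrite gt_eqF.
    by rewrite /= !ptE.
  by split; rewrite /= !ptE; field.
have EA : Al (pt x y 0 0) = Al o.
  apply: K => x' y' ; last move=> c c1 c2; move=> y'0 p; have y'n : y' != 0 by rewrite gt_eqF.
    by rewrite /= !ptE.
  by split; rewrite /= !ptE; field.
move: EG EB EA; rewrite /Ga /Be /Al /comb3 /= !ptE invr1.
move: (f _) (f1 _) (f2 _) => a b c.
move: (f o) (f1 o) (f2 o) => a0 b0 c0 EG EB EA.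
have -> : (a0 + c0) / 2 = a * (1 / 2 * y^-1) + b * 0 + c * (1 / 2 * y^-1).
  by rewrite EG; field.
have -> : b0 = a * - (x / y) + b * 1 + c * - (x / y) by rewrite EB; ring.
have -> : (a0 - c0) / 2 = a * (y + (x * x - y * y) * (1 / 2 / y)) + b * - x +
     c * ((x * x - y * y) * (1 / 2 / y)) by rewrite EA; field.
by field.
Qed.

End Slices.

(** * The jet of an isometry along the zero section *)

Section Base.
Context {R : realType} (k : R) (k_gt0 : 0 < k).
Local Notation V := 'rV[R]_4.
Local Notation G := (rmx (metric_rows k)).
Local Notation A := (connection k).
Local Notation H := (H2C R).
Context (h : V -> V) (hI : chart_isometry k h).
Local Notation J := (Jac h).

Lemma iso_Jac_partial l p : H p ->
  mxpartial l J p = A l p *m J p - J p *m pull_conn A h l p.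
Proof.
case: hI => hU hd h3 hi Hp.
apply: (Jac_partial (@H2C_open R) (g := G)) => //.
- by move=> q Hq; exact: rmx_diff (metric_rows_def k Hq).
- by move=> q Hq; exact: (metric_rows_sym k q).
- by move=> q Hq; exact: (metric_unit k_gt0 Hq).
- by move=> q m Hq; exact: (connection_lc k_gt0 m Hq).
Qed.

(** A partial derivative sees only the restriction to a line, so equalities on the
    zero section or on a fibre can be differentiated along it. *)
Lemma partial_line (F F' : V -> R) (l : 'I_4) p :
  differentiable F p -> differentiable F' p ->
  (\forall s \near (0 : R), F (p + s *: delta_mx 0 l) = F' (p + s *: delta_mx 0 l)) ->
  partial l F p = partial l F' p.
Proof.
move=> dF dF' E; rewrite partial.unlock.
have p0 : p + 0 *: delta_mx 0 l = p by rewrite scale0r addr0.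
have d1 : derivable F (p + 0 *: delta_mx 0 l) (delta_mx 0 l) by rewrite p0; exact: diff_derivable.
have d2 : derivable F' (p + 0 *: delta_mx 0 l) (delta_mx 0 l) by rewrite p0; exact: diff_derivable.
have [_] := is_derive_line d1; rewrite p0 => <-.
have [_] := is_derive_line d2; rewrite p0 => <-.
exact: near_eq_derive.
Qed.

Lemma h_entry_diff j p : H p -> differentiable (fun q => h q 0 j) p.
Proof. by move=> Hp; exact: (differentiable_entry 0 j (iso_diff hI Hp)). Qed.

Lemma near_y (y c : R) : 0 < y -> \forall s \near (0 : R), 0 < y + s * c.
Proof.
move=> y0; have : (fun s : R => y + s * c) @ (0 : R) --> y + 0 * c.
  by apply: cvgD; [exact: cvg_cst|apply: cvgM; [exact: cvg_id|exact: cvg_cst]].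
by rewrite mul0r addr0 => /cvgr_gt; apply.
Qed.

(** Because h maps the zero section into itself. *)
Lemma Jac_base_fibre x y (i j : 'I_4) : 0 < y -> (i < 2)%N -> (2 <= j)%N ->
  J (pt x y 0 0) i j = 0.
Proof.
move=> y0 i2 j2; have Hp : H (pt x y 0 0) by rewrite H_pt.
rewrite JacE; apply: (etrans _ (partial_cst (0 : R) i (pt x y 0 0))).
apply: partial_line; [exact: (h_entry_diff j Hp)|exact: differentiable_cst|].
have := near_y ((delta_mx 0 i : V) 0 1) y0; apply: filterS => s ys.
rewrite ptD.
have [-> ->] : (delta_mx 0 i : V) 0 2 = 0 /\ (delta_mx 0 i : V) 0 3 = 0.
  by rewrite !mxE; case: i i2 {Hp ys} => [[|[|]]].
rewrite mulr0 addr0.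
have [e2 e3] := zero_section k_gt0 hI (x + s * (delta_mx 0 i : V) 0 0) ys.
case: j j2 => [[|[|[|[|//]]]] hj] // _.
  by rewrite -[RHS]e2; congr (h _ _ _); exact: val_inj.
by rewrite -[RHS]e3; congr (h _ _ _); exact: val_inj.
Qed.

Lemma Jac_fibre_base x y u v (i j : 'I_4) : 0 < y -> (2 <= i)%N -> (j < 2)%N ->
  J (pt x y u v) i j = 0.
Proof.
move=> y0 i2 j2; have Hp : H (pt x y u v) by rewrite H_pt.
rewrite JacE; apply: (etrans _ (partial_cst (h (pt x y 0 0) 0 j) i (pt x y u v))).
apply: partial_line; [exact: (h_entry_diff j Hp)|exact: differentiable_cst|].
near=> s; rewrite ptD.
have [-> ->] : (delta_mx 0 i : V) 0 0 = 0 /\ (delta_mx 0 i : V) 0 1 = 0.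
  by rewrite !mxE; case: i i2 {Hp} => [[|[|]]].
by rewrite mulr0 !addr0 (fibre_const k_gt0 hI).
Unshelve. all: by end_near. Qed.

Lemma Jac_fibre_fibre x y u v (i j : 'I_4) : 0 < y -> (2 <= i)%N -> (2 <= j)%N ->
  J (pt x y u v) i j = J (pt x y 0 0) i j.
Proof.
move=> y0 i2 j2; have Hp : H (pt x y u v) by rewrite H_pt.
rewrite [LHS]JacE.
pose e : @rexpr R := RAdd (RMul RU (RC (J (pt x y 0 0) 2 j))) (RMul RV (RC (J (pt x y 0 0) 3 j))).
have -> : J (pt x y 0 0) i j = partial i (reval e) (pt x y u v).
  rewrite reval_partial//=; case: i i2 => [[|[|[|[|//]]]] hi] //= _; rewrite !ptE.
    by rewrite !mulr0 mul1r !mul0r !addr0; congr (J _ _ _); exact: val_inj.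
  by rewrite !mulr0 mul1r !mul0r !addr0 !add0r; congr (J _ _ _); exact: val_inj.
apply: partial_line; [exact: (h_entry_diff j Hp)|exact: reval_diff|].
near=> s; rewrite ptD.
have [-> ->] : (delta_mx 0 i : V) 0 0 = 0 /\ (delta_mx 0 i : V) 0 1 = 0.
  by rewrite !mxE; case: i i2 => [[|[|]]].
by rewrite mulr0 !addr0 (fibre_linear k_gt0 hI)//= !ptE.
Unshelve. all: by end_near. Qed.

(** The base block of the isometry equation on the zero section, where the metric
    is block diagonal with base block y^-2. *)
Lemma base_conformal x y : 0 < y -> let p := pt x y 0 0 in
  [/\ J p 0 0 ^+ 2 + J p 0 1 ^+ 2 = (h p 0 1 / y) ^+ 2,
      J p 1 0 ^+ 2 + J p 1 1 ^+ 2 = (h p 0 1 / y) ^+ 2 &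
      J p 0 0 * J p 1 0 + J p 0 1 * J p 1 1 = 0].
Proof.
move=> y0 p; have Hp : H p by rewrite H_pt.
have yn : y != 0 by rewrite gt_eqF.
have Yn := lt0r_neq0 (H2C_y (iso_H hI Hp)).
have [e2 e3] := zero_section k_gt0 hI x y0.
have z (i : 'I_4) (hi : (i < 2)%N) := (Jac_base_fibre x y0 hi (isT : (2 <= (2%R : 'I_4))%N),
  Jac_base_fibre x y0 hi (isT : (2 <= (3%R : 'I_4))%N)).
have /matrixP M := iso_metric hI Hp.
have E (i j : 'I_4) : (i < 2)%N -> (j < 2)%N -> J p i 0 * J p j 0 + J p i 1 * J p j 1
    = (h p 0 1) ^+ 2 * G p i j.
  move=> hi hj; rewrite -M mxE sum_ord4.
  rewrite !mulmx4E ![(_^T) _ _]mxE !(z i hi) !(z j hj) !mxE /= /p e2 e3.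
  by field; rewrite ?Yn.
have := E 0 0 isT isT; have := E 0 1 isT isT; have := E 1 1 isT isT.
rewrite !mxE /= !ptE => E11 E01 E00; split.
- by rewrite !expr2 E00; field; rewrite ?yn.
- by rewrite !expr2 E11; field; rewrite ?yn.
- by rewrite E01 mulr0.
Qed.

(** The base block of [Jac_partial] on the zero section, where the connection is
    that of the hyperbolic plane. *)
Lemma base_second_derivative x y : 0 < y -> let p := pt x y 0 0 in
  let Y := h p 0 1 in
  forall i : 'I_4, (i < 2)%N ->
  [/\ mxpartial 0 J p i 0 = (if i == 0 then J p 1 0 else - J p 0 0) / y
        + (J p i 0 * J p 0 1 + J p i 1 * J p 0 0) / Y,
      mxpartial 0 J p i 1 = (if i == 0 then J p 1 1 else - J p 0 1) / y
        - (J p i 0 * J p 0 0 - J p i 1 * J p 0 1) / Y,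
      mxpartial 1 J p i 0 = - J p i 0 / y
        + (J p i 0 * J p 1 1 + J p i 1 * J p 1 0) / Y &
      mxpartial 1 J p i 1 = - J p i 1 / y
        - (J p i 0 * J p 1 0 - J p i 1 * J p 1 1) / Y].
Proof.
move=> y0 p Y i hi; have Hp : H p by rewrite H_pt.
have yn : y != 0 by rewrite gt_eqF.
have Yn := lt0r_neq0 (H2C_y (iso_H hI Hp)).
have [e2 e3] := zero_section k_gt0 hI x y0.
have z (a : 'I_4) (ha : (a < 2)%N) := (Jac_base_fibre x y0 ha (isT : (2 <= (2%R : 'I_4))%N),
  Jac_base_fibre x y0 ha (isT : (2 <= (3%R : 'I_4))%N)).
have eB (P Q : 'M[R]_4) a b : (P - Q) a b = P a b - Q a b by rewrite !mxE.
have eL (l a b : 'I_4) : pull_conn A h l p a b = J p l 0 * A 0 (h p) a b + J p l 1 * A 1 (h p) a b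
   + J p l 2 * A 2 (h p) a b + J p l 3 * A 3 (h p) a b.
  by rewrite /pull_conn summxE sum_ord4 !mxE.
have i01 : i = 0 \/ i = 1.
  by case: i hi => [[|[|//]] hi] _; [left|right]; apply: val_inj.
have A0 l a b : (A l p *m J p) a b = A l p a 0 * J p 0 b + A l p a 1 * J p 1 b
    + A l p a 2 * J p 2 b + A l p a 3 * J p 3 b by exact: mulmx4E.
have B0 l a b : (J p *m pull_conn A h l p) a b = J p a 0 * pull_conn A h l p 0 b
    + J p a 1 * pull_conn A h l p 1 b + J p a 2 * pull_conn A h l p 2 b
    + J p a 3 * pull_conn A h l p 3 b by exact: mulmx4E.
have z0 := z 0 isT; have z1 := z 1 isT.
case: i01 => -> {i hi}; split; rewrite (iso_Jac_partial _ Hp) eB A0 B0 !eL.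
all: rewrite ?z0 ?z1 !mxE /= ?ptE /Y /p ?e2 ?e3.
all: rewrite !(mulr0, mul0r, addr0, add0r, invr1, mulr1, oppr0).
all: by field; rewrite ?yn ?Yn.
Qed.
End Base.

(** * Elementary algebra of the plane *)

Section PlaneAlgebra.
Context {R : realType}.

(** Certificate for an identity that holds modulo the relation x = y. *)
Lemma eq_lincomb (a b c x y : R) : x = y -> a - b = c * (x - y) -> a = b.
Proof. by move=> ->; rewrite subrr mulr0 => /eqP; rewrite subr_eq0 => /eqP. Qed.

(** By Lagrange's identity the determinant is N, and then
    (c + b)^2 + (e - a)^2 = 2 N - 2 N = 0. *)
Lemma conformal_positive (a b c e N : R) :
  a ^+ 2 + b ^+ 2 = N -> c ^+ 2 + e ^+ 2 = N -> a * c + b * e = 0 ->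
  0 < a * e - b * c -> c = - b /\ e = a.
Proof.
move=> E1 E2 E3 d0.
have N0 : 0 <= N by rewrite -E1 addr_ge0 ?sqr_ge0.
have dN : a * e - b * c = N.
  apply/eqP; rewrite -(eqrXn2 (n := 2)) ?(ltW d0)//; apply/eqP.
  have -> : (a * e - b * c) ^+ 2 = (a ^+ 2 + b ^+ 2) * (c ^+ 2 + e ^+ 2) - (a * c + b * e) ^+ 2.
    by ring.
  by rewrite E1 E2 E3; ring.
have /eqP : (c + b) ^+ 2 + (e - a) ^+ 2 = 0.
  have -> : (c + b) ^+ 2 + (e - a) ^+ 2 =
    (a ^+ 2 + b ^+ 2) + (c ^+ 2 + e ^+ 2) - 2 * (a * e - b * c) by ring.
  by rewrite E1 E2 dN; ring.
rewrite paddr_eq0 ?sqr_ge0// !sqrf_eq0 addr_eq0 subr_eq0 => /andP[/eqP -> /eqP ->].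
by [].
Qed.

(** Extracts the lower row (c, d) of a matrix of SL(2, R) from the quadratic form
    (c x + d)^2 + c^2 y^2 that it determines. *)
Lemma half_angle (al be ga : R) : 0 <= al -> 0 <= ga -> be ^+ 2 = 4 * al * ga ->
  exists c d : R, [/\ c ^+ 2 = ga, d ^+ 2 = al & 2 * c * d = be].
Proof.
move=> al0 ga0 E.
have S : (2 * Num.sqrt ga * Num.sqrt al) ^+ 2 = be ^+ 2.
  by rewrite !exprMn !sqr_sqrtr// E; ring.
have /orP[/eqP H1|/eqP H1] : (2 * Num.sqrt ga * Num.sqrt al == be) ||
      (2 * Num.sqrt ga * Num.sqrt al == - be) by rewrite -eqf_sqr S.
  by exists (Num.sqrt ga), (Num.sqrt al); rewrite !sqr_sqrtr.
exists (- Num.sqrt ga), (Num.sqrt al); rewrite sqrrN !sqr_sqrtr//; split=> //.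
by rewrite -[be]opprK -H1; ring.
Qed.

Lemma unit_circle (s t : R) : s ^+ 2 + t ^+ 2 = 1 ->
  exists theta : R, cos theta = s /\ sin theta = t.
Proof.
move=> E; have s1 : -1 <= s <= 1 by apply/andP; split; nra.
have t2 : Num.sqrt (1 - s ^+ 2) = `|t| by rewrite -E addrAC subrr add0r sqrtr_sqr.
have [t0|t0] := leP 0 t.
  by exists (acos s); rewrite acosK ?sin_acos// t2 ger0_norm.
exists (- acos s); rewrite cosN sinN acosK ?sin_acos// t2 ltr0_norm// opprK.
by [].
Qed.

End PlaneAlgebra.

(** * The map of the base is a Moebius map or its conjugate *)

Section Mobius.
Context {R : realType} (k : R) (k_gt0 : 0 < k).
Local Notation V := 'rV[R]_4.
Local Notation H := (H2C R).
Context (h : V -> V) (hI : chart_isometry k h).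
Local Notation J := (Jac h).

Lemma reval_comp_partial (e : @rexpr R) (l : 'I_4) p : H p -> rdef e (h p) ->
  differentiable (fun q => reval e (h q)) p /\
  partial l (fun q => reval e (h q)) p =
    J p l 0 * reval (rderiv 0 e) (h p) + J p l 1 * reval (rderiv 1 e) (h p)
    + J p l 2 * reval (rderiv 2 e) (h p) + J p l 3 * reval (rderiv 3 e) (h p).
Proof.
move=> Hp de; have dh := iso_diff hI Hp; have dr := reval_diff de; split.
  exact: (@differentiable_comp _ _ _ _ h (reval e)).
by rewrite partial_comp// sum_ord4 !reval_partial// !JacE.
Qed.

(** The equation Hess q = q g for the hyperbolic metric g, in coordinates, for a
    function q of the base coordinates only. *)
Definition hessian_form (q : @rexpr R) : Prop := forall P, H P ->
  let Y := P 0 1 in let d i := rderiv i q in let dd i j := reval (rderiv i (rderiv j q)) P in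
  [/\ rdef q P, rdef (d 0%N) P & rdef (d 1%N) P] /\
  [/\ reval (d 2%N) P = 0, reval (d 3%N) P = 0, dd 2%N 0%N = 0, dd 3%N 0%N = 0 &
      dd 2%N 1%N = 0 /\ dd 3%N 1%N = 0] /\
  [/\ dd 0%N 0%N = (reval (d 1%N) P * Y + reval q P) / Y ^+ 2,
      dd 0%N 1%N = - reval (d 0%N) P / Y,
      dd 1%N 0%N = - reval (d 0%N) P / Y &
      dd 1%N 1%N = (- reval (d 1%N) P * Y + reval q P) / Y ^+ 2].

(** The derivative of q o h along y times the i-th coordinate vector. *)
Definition frame_deriv (q : @rexpr R) (i : 'I_4) (p : V) : R :=
  reval RY p * (J p i 0 * reval (rderiv 0 q) (h p) + J p i 1 * reval (rderiv 1 q) (h p)).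

Lemma frame_deriv_partial q (l i : 'I_4) p : hessian_form q -> H p ->
  differentiable (frame_deriv q i) p /\
  partial l (frame_deriv q i) p =
   reval (rderiv l RY) p * (J p i 0 * reval (rderiv 0 q) (h p) + J p i 1 * reval (rderiv 1 q) (h p))
   + reval RY p *
     (mxpartial l J p i 0 * reval (rderiv 0 q) (h p)
      + J p i 0 * (J p l 0 * reval (rderiv 0 (rderiv 0 q)) (h p)
                   + J p l 1 * reval (rderiv 1 (rderiv 0 q)) (h p))
      + (mxpartial l J p i 1 * reval (rderiv 1 q) (h p)
      + J p i 1 * (J p l 0 * reval (rderiv 0 (rderiv 1 q)) (h p)
                   + J p l 1 * reval (rderiv 1 (rderiv 1 q)) (h p)))).
Proof.
move=> bq Hp; have [[d d0 d1] [[_ _ z20 z30 [z21 z31]] _]] := bq _ (iso_H hI Hp).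
have [dc0 pc0] := reval_comp_partial l Hp d0.
have [dc1 pc1] := reval_comp_partial l Hp d1.
have dJ0 := iso_Jac_diff hI i 0 Hp; have dJ1 := iso_Jac_diff hI i 1 Hp.
have dm0 := differentiableM dJ0 dc0; have dm1 := differentiableM dJ1 dc1.
have ds := differentiableD dm0 dm1.
have dy : differentiable (reval (@RY R)) p by exact: reval_diff.
split; first exact: differentiableM dy ds.
rewrite (partialM l dy ds) (reval_partial l (e := RY))//.
rewrite (partialD l dm0 dm1) (partialM l dJ0 dc0) (partialM l dJ1 dc1) -!mxpartialE.
by rewrite pc0 pc1 z20 z30 z21 z31 !mulr0 !addr0.
Qed.

(** The equation Hess q = q g is invariant under isometries of the hyperbolic
    plane, so q o h satisfies it as well and [hyperbolic_hessian] applies. *)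
Lemma hessian_form_pullback q : hessian_form q ->
  let f p := reval q (h p) in let f1 := frame_deriv q 0 in let f2 := frame_deriv q 1 in
  let o := pt 0 1 0 0 in
  forall x y, 0 < y -> f (pt x y 0 0) =
    ((f o - f2 o) / 2 + f1 o * x + (f o + f2 o) / 2 * (x ^+ 2 + y ^+ 2)) / y.
Proof.
move=> bq f f1 f2; apply: hyperbolic_hessian => x y y0 p.
have Hp : H p by rewrite H_pt.
have HP := iso_H hI Hp.
have yn : y != 0 by rewrite gt_eqF.
have Yn := lt0r_neq0 (H2C_y HP).
have [[d d0 d1] [[z2 z3 _ _ _] [q00 q01 q10 q11]]] := bq _ HP.
have [df pf0] := reval_comp_partial 0 Hp d.
have [_ pf1] := reval_comp_partial 1 Hp d.
have [df1 p10] := frame_deriv_partial 0 0 bq Hp.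
have [_ p11] := frame_deriv_partial 1 0 bq Hp.
have [df2 p20] := frame_deriv_partial 0 1 bq Hp.
have [_ p21] := frame_deriv_partial 1 1 bq Hp.
have [c00 c11 c01] := base_conformal k_gt0 hI x y0.
have [s00 s01 t00 t01] := base_second_derivative k_gt0 hI x y0 (isT : (0%R : 'I_4) < 2)%N.
have [s10 s11 t10 t11] := base_second_derivative k_gt0 hI x y0 (isT : (1%R : 'I_4) < 2)%N.
have py : p 0 1 = y by rewrite ptE.
rewrite /f /f1 /f2; split; first by split.
rewrite {}pf0 {}pf1 {}p10 {}p11 {}p20 {}p21 z2 z3 q00 q01 q10 q11.
rewrite -/p in c00 c11 c01 s00 s01 t00 t01 s10 s11 t10 t11 *.
rewrite s00 s01 t00 t01 s10 s11 t10 t11 /frame_deriv.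
rewrite /= !py.
move: (reval q (h p)) (reval (rderiv 0 q) (h p)) (reval (rderiv 1 q) (h p)) => Q Q0 Q1.
move: (J p 0 0) (J p 0 1) (J p 1 0) (J p 1 1) (h p 0 1) Yn c00 c11 c01 => a b c e Y Yn c00 c11 c01.
split; [split|split].
- by ring.
- by ring.
- by apply: (eq_lincomb (c := Q * y ^+ 2 / Y ^+ 2) c00); field; rewrite ?yn ?Yn.
- by apply: (eq_lincomb (c := Q * y ^+ 2 / Y ^+ 2) c01); field; rewrite ?yn ?Yn.
- by apply: (eq_lincomb (c := Q * y ^+ 2 / Y ^+ 2) c01); field; rewrite ?yn ?Yn.
- by apply: (eq_lincomb (c := Q * y ^+ 2 / Y ^+ 2) c11); field; rewrite ?yn ?Yn.
Qed.

Definition hyperboloid1 : @rexpr R := RInv RY.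
Definition hyperboloid2 : @rexpr R := RMul RX (RInv RY).
Definition hyperboloid3 : @rexpr R := RMul (RAdd (RMul RX RX) (RMul RY RY)) (RInv RY).

Lemma hyperboloid1_form : hessian_form hyperboloid1.
Proof.
move=> P /H2C_y/lt0r_neq0 Yn Y; rewrite /Y {Y} /=.
by do !split => //; field; rewrite ?Yn.
Qed.

Lemma hyperboloid2_form : hessian_form hyperboloid2.
Proof.
move=> P /H2C_y/lt0r_neq0 Yn Y; rewrite /Y {Y} /=.
by do !split => //; field; rewrite ?Yn.
Qed.

Lemma hyperboloid3_form : hessian_form hyperboloid3.
Proof.
move=> P /H2C_y/lt0r_neq0 Yn Y; rewrite /Y {Y} /=.
by do !split => //; field; rewrite ?Yn.
Qed.

End Mobius.

Section BaseMap.
Context {R : realType} (k : R) (k_gt0 : 0 < k).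
Local Notation V := 'rV[R]_4.
Local Notation H := (H2C R).
Context (h : V -> V) (hI : chart_isometry k h).
Local Notation J := (Jac h).
Local Notation o := (pt 0 1 0 0 : V).

Lemma h_y_gt0 x y u v : 0 < y -> 0 < h (pt x y u v) 0 1.
Proof. by move=> y0; apply/H2C_y/(iso_H hI); rewrite H_pt. Qed.

(** The determinant of three points of the hyperboloid. It tells the two
    orientations of the base map apart through values of h only, which are what
    the compact-open topology controls. *)
Definition base_wedge (A B C : V) : R :=
  let d P Q := reval hyperboloid2 P * reval hyperboloid3 Q
    - reval hyperboloid3 P * reval hyperboloid2 Q in
  reval hyperboloid1 A * d B C - reval hyperboloid1 B * d A C + reval hyperboloid1 C * d A B.

(** The function of [hyperbolic_hessian] with the given 1-jet at (0, 1). *)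
Definition expansion (f f1 f2 x y : R) : R :=
  ((f - f2) / 2 + f1 * x + (f + f2) / 2 * (x ^+ 2 + y ^+ 2)) / y.

Lemma hyperboloid_expansion x y : 0 < y ->
  let X := h o 0 0 in let Y := h o 0 1 in let P := h (pt x y 0 0) in
  [/\ reval hyperboloid1 P = expansion Y^-1 (- J o 0 1 / Y ^+ 2) (- J o 1 1 / Y ^+ 2) x y,
      reval hyperboloid2 P = expansion (X / Y) (J o 0 0 / Y - X * J o 0 1 / Y ^+ 2)
                                     (J o 1 0 / Y - X * J o 1 1 / Y ^+ 2) x y &
      reval hyperboloid3 P = expansion ((X ^+ 2 + Y ^+ 2) / Y)
         (2 * X * J o 0 0 / Y + J o 0 1 * (1 - X ^+ 2 / Y ^+ 2))
         (2 * X * J o 1 0 / Y + J o 1 1 * (1 - X ^+ 2 / Y ^+ 2)) x y].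
Proof.
move=> y0 X Y P; have Yn : Y != 0 := lt0r_neq0 (@h_y_gt0 0 1 0 0 ltr01).
have y1 : (o : V) 0 1 = 1 by rewrite ptE.
split.
- have /= -> := hessian_form_pullback k_gt0 hI (@hyperboloid1_form R) x y0.
  rewrite /frame_deriv /= -/X -/Y y1 /expansion.
  by congr (_ / y); field; rewrite ?Yn.
- have /= -> := hessian_form_pullback k_gt0 hI (@hyperboloid2_form R) x y0.
  rewrite /frame_deriv /= -/X -/Y y1 /expansion.
  by congr (_ / y); field; rewrite ?Yn.
- have /= -> := hessian_form_pullback k_gt0 hI (@hyperboloid3_form R) x y0.
  rewrite /frame_deriv /= -/X -/Y y1 /expansion.
  by congr (_ / y); field; rewrite ?Yn.
Qed.

(** The base map acts on the hyperboloid by a linear map whose determinant is that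
    of its orthonormalized differential; -3/2 is the value for the identity. *)
Lemma base_wedge_iso :
  base_wedge (h (pt 0 1 0 0)) (h (pt 0 2 0 0)) (h (pt 1 1 0 0)) =
  - (3 / 2) * (J o 0 0 * J o 1 1 - J o 0 1 * J o 1 0) / (h o 0 1) ^+ 2.
Proof.
have Yn := lt0r_neq0 (@h_y_gt0 0 1 0 0 ltr01).
have t20 : (0 : R) < 2 by [].
have [a1 a2 a3] := hyperboloid_expansion 0 ltr01.
have [b1 b2 b3] := hyperboloid_expansion 0 t20.
have [c1 c2 c3] := hyperboloid_expansion 1 ltr01.
rewrite /base_wedge a1 a2 a3 b1 b2 b3 c1 c2 c3 /expansion.
move: {a1 a2 a3 b1 b2 b3 c1 c2 c3} (J o 0 0) (J o 0 1) (J o 1 0) (J o 1 1) => a b c e.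
move: (h o 0 1) (h o 0 0) Yn => Y X Yn.
by field; rewrite ?Yn.
Qed.

(** Lagrange's identity for the rows of a conformal matrix. *)
Lemma base_jacobian_sqr :
  (J o 0 0 * J o 1 1 - J o 0 1 * J o 1 0) ^+ 2 = (h o 0 1) ^+ 4.
Proof.
have [] := base_conformal k_gt0 hI 0 (ltr01 : 0 < 1 :> R).
rewrite divr1; move: (J o 0 0) (J o 0 1) (J o 1 0) (J o 1 1) (h o 0 1) => a b c e Y.
move=> c00 c11 c01.
have -> : (a * e - b * c) ^+ 2 = (a ^+ 2 + b ^+ 2) * (c ^+ 2 + e ^+ 2) - (a * c + b * e) ^+ 2.
  by ring.
by rewrite c00 c11 c01; ring.
Qed.

Lemma base_wedge_neq0 :
  base_wedge (h (pt 0 1 0 0)) (h (pt 0 2 0 0)) (h (pt 1 1 0 0)) != 0.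
Proof.
have Yn := lt0r_neq0 (@h_y_gt0 0 1 0 0 ltr01).
have dn : J o 0 0 * J o 1 1 - J o 0 1 * J o 1 0 != 0.
  by rewrite -sqrf_eq0 base_jacobian_sqr expf_eq0.
by rewrite base_wedge_iso !mulf_neq0// ?invr_neq0 ?expf_neq0// oppr_eq0.
Qed.

(** Tells whether the real-linear map of a fibre preserves its orientation. *)
Definition fibre_wedge (A B : V) : R := A 0 2 * B 0 3 - A 0 3 * B 0 2.

(** A linear map of the fibre that scales all norms is conformal. *)
Lemma fibre_wedge_iso x y : 0 < y ->
  let J0 := J (pt x y 0 0) in
  [/\ fibre_wedge (h (pt x y 1 0)) (h (pt x y 0 1)) = J0 2 2 * J0 3 3 - J0 2 3 * J0 3 2,
      (h (pt x y 0 0) 0 1) ^+ 3 * (J0 2 2 ^+ 2 + J0 2 3 ^+ 2) = y ^+ 3,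
      (h (pt x y 0 0) 0 1) ^+ 3 * (J0 3 2 ^+ 2 + J0 3 3 ^+ 2) = y ^+ 3 &
      J0 2 2 * J0 3 2 + J0 2 3 * J0 3 3 = 0].
Proof.
move=> y0 J0.
have Y0 := @h_y_gt0 x y 0 0 y0.
have T u v : H (pt x y u v) -> _ := iso_tau k_gt0 hI (p := pt x y u v).
have L j u v := fibre_linear k_gt0 hI x u v y0 (j := j).
have E u v : h (pt x y 0 0) 0 1 ^+ 3 *
   ((u * J0 2 2 + v * J0 3 2) ^+ 2 + (u * J0 2 3 + v * J0 3 3) ^+ 2) =
   y ^+ 3 * (u ^+ 2 + v ^+ 2).
  by have := T u v; rewrite H_pt => /(_ y0); rewrite !ptE (L 2)// (L 3)// (fibre_const k_gt0 hI).
rewrite /fibre_wedge !(L 2)// !(L 3)// -/J0.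
have := E 1 0; have := E 0 1; have := E 1 1.
move: {E T L} (J0 2 2) (J0 2 3) (J0 3 2) (J0 3 3) (h _ 0 1) Y0 => a b c e Y Y0.
rewrite !(mul0r, mul1r, addr0, add0r, expr0n, expr1n, mulr1) /= => E3 E2 E1.
split; [by ring|by []|by []|].
have Yn : Y ^+ 3 != 0 by rewrite expf_neq0 ?gt_eqF.
apply: (mulfI Yn); rewrite mulr0.
have : Y ^+ 3 * ((a + c) ^+ 2 + (b + e) ^+ 2) - Y ^+ 3 * (a ^+ 2 + b ^+ 2)
  - Y ^+ 3 * (c ^+ 2 + e ^+ 2) = 0 by rewrite E1 E2 E3; ring.
move=> E; apply: (@mulfI _ 2) => //; rewrite mulr0 -E; ring.
Qed.

Lemma fibre_wedge_neq0 x y : 0 < y ->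
  fibre_wedge (h (pt x y 1 0)) (h (pt x y 0 1)) != 0.
Proof.
move=> y0; have [-> ] := fibre_wedge_iso x y0.
have Y0 := @h_y_gt0 x y 0 0 y0.
set J0 := J _.
move: (J0 2 2) (J0 2 3) (J0 3 2) (J0 3 3) (h _ 0 1) Y0 => a b c e Y Y0 E1 E2 E3.
have : (Y ^+ 3 * (a * e - b * c)) ^+ 2 = (y ^+ 3) ^+ 2.
  have -> : (Y ^+ 3 * (a * e - b * c)) ^+ 2 = (Y ^+ 3 * (a ^+ 2 + b ^+ 2)) *
     (Y ^+ 3 * (c ^+ 2 + e ^+ 2)) - (Y ^+ 3) ^+ 2 * (a * c + b * e) ^+ 2 by ring.
  by rewrite E1 E2 E3; ring.
move=> E; apply/eqP => d0; move: E; rewrite d0 mulr0 expr0n /= => /esym/eqP.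
by rewrite !expf_eq0 /= gt_eqF.
Qed.

(** The form 1/y o h is nonnegative and degenerate, so it is |c z + d|^2 / y for
    some real c and d. The 1-jet of h at i then gives the upper row of the matrix,
    and the expansion of x/y o h gives the first coordinate. *)
Lemma base_mobius :
  0 < J o 0 0 * J o 1 1 - J o 0 1 * J o 1 0 ->
  exists a b c d : R, a * d - b * c = 1 /\
  forall x y, 0 < y ->
    h (pt x y 0 0) 0 1 = y / ((c * x + d) ^+ 2 + (c * y) ^+ 2) /\
    h (pt x y 0 0) 0 0 =
      (a * c * (x ^+ 2 + y ^+ 2) + (a * d + b * c) * x + b * d)
        / ((c * x + d) ^+ 2 + (c * y) ^+ 2).
Proof.
move=> d0; have Y0 := @h_y_gt0 0 1 0 0 ltr01.
have [] := base_conformal k_gt0 hI 0 (ltr01 : 0 < 1 :> R).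
rewrite divr1 => c00 c11 c01.
have [J10 J11] := conformal_positive c00 c11 c01 d0.
have F1 x y (y0 : 0 < y) : (h (pt x y 0 0) 0 1)^-1 = _ :=
  let: And3 F _ _ := hyperboloid_expansion x y0 in F.
have F2 x y (y0 : 0 < y) : h (pt x y 0 0) 0 0 / h (pt x y 0 0) 0 1 = _ :=
  let: And3 _ F _ := hyperboloid_expansion x y0 in F.
move: F1 F2; rewrite J10 J11 /expansion => F1 F2.
move: (J o 0 0) (J o 0 1) (h o 0 1) (h o 0 0) Y0 c00 F1 F2 => P Q Y X Y0 c00 F1 F2.
have Yn := lt0r_neq0 Y0.
have PY : P ^+ 2 <= Y ^+ 2 by rewrite -c00 lerDl sqr_ge0.
have /andP[P1 P2] : - Y <= P <= Y.
  by apply/andP; split; nra.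
have al0 : 0 <= (Y + P) / (2 * Y ^+ 2).
  by rewrite divr_ge0 ?mulr_ge0 ?exprn_ge0 ?(ltW Y0)//; lra.
have ga0 : 0 <= (Y - P) / (2 * Y ^+ 2).
  by rewrite divr_ge0// ?mulr_ge0 ?exprn_ge0 ?(ltW Y0)// subr_ge0.
have Q2 : Q ^+ 2 = Y ^+ 2 - P ^+ 2 by rewrite -c00; ring.
have be2 : (- Q / Y ^+ 2) ^+ 2 = 4 * ((Y + P) / (2 * Y ^+ 2)) * ((Y - P) / (2 * Y ^+ 2)).
  by rewrite expr_div_n sqrrN Q2; field; rewrite ?Yn.
have [c [d [c2 d2 cd]]] := half_angle al0 ga0 be2.
have cd2 : c ^+ 2 + d ^+ 2 = Y^-1 by rewrite c2 d2; field; rewrite ?Yn.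
exists (X * c + Y * d), (X * d - Y * c), c, d; split.
  have -> : (X * c + Y * d) * d - (X * d - Y * c) * c = Y * (c ^+ 2 + d ^+ 2) by ring.
  by rewrite cd2 mulfV.
move=> x y y0; have yn := lt0r_neq0 y0.
have Y'n := lt0r_neq0 (@h_y_gt0 x y 0 0 y0).
have mE : (c * x + d) ^+ 2 + (c * y) ^+ 2 = y / h (pt x y 0 0) 0 1.
  have -> : (c * x + d) ^+ 2 + (c * y) ^+ 2 =
    c ^+ 2 * (x ^+ 2 + y ^+ 2) + 2 * c * d * x + d ^+ 2 by ring.
  by rewrite F1// c2 d2 cd; field; rewrite ?yn ?Yn.
have nE : (X * c + Y * d) * c * (x ^+ 2 + y ^+ 2)
   + ((X * c + Y * d) * d + (X * d - Y * c) * c) * x + (X * d - Y * c) * d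
   = y * (h (pt x y 0 0) 0 0 / h (pt x y 0 0) 0 1).
  have -> : (X * c + Y * d) * c * (x ^+ 2 + y ^+ 2)
   + ((X * c + Y * d) * d + (X * d - Y * c) * c) * x + (X * d - Y * c) * d
   = (X * c ^+ 2 + Y / 2 * (2 * c * d)) * (x ^+ 2 + y ^+ 2) +
     (X * (2 * c * d) + Y * (d ^+ 2 - c ^+ 2)) * x + (X * d ^+ 2 - Y / 2 * (2 * c * d)).
    by field.
  by rewrite F2// c2 d2 cd; field; rewrite ?yn ?Yn.
by rewrite nE mE; split; field; rewrite ?yn ?Y'n.
Qed.

End BaseMap.

(** * The map of the fibres is a rotation *)

Section Rotation.
Context {R : realType} (k : R) (k_gt0 : 0 < k).
Local Notation V := 'rV[R]_4.
Local Notation H := (H2C R).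
Local Notation G := (rmx (metric_rows k)).
Context (h : V -> V) (hI : chart_isometry k h).
Local Notation J := (Jac h).

Section MobiusBase.
Context (a b c d : R) (det1 : a * d - b * c = 1).
Hypothesis mob : forall x y, 0 < y ->
    h (pt x y 0 0) 0 1 = y / ((c * x + d) ^+ 2 + (c * y) ^+ 2) /\
    h (pt x y 0 0) 0 0 =
      (a * c * (x ^+ 2 + y ^+ 2) + (a * d + b * c) * x + b * d)
        / ((c * x + d) ^+ 2 + (c * y) ^+ 2).
Hypothesis fibre_pos : forall x y, 0 < y -> 0 < fibre_wedge (h (pt x y 1 0)) (h (pt x y 0 1)).

(** The number c z + d is not 0, as z is not real and (c, d) is not 0. *)
Lemma denom_gt0 x y : 0 < y -> 0 < (c * x + d) ^+ 2 + (c * y) ^+ 2.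
Proof.
move=> y0; rewrite lt_def addr_ge0 ?sqr_ge0// andbT paddr_eq0 ?sqr_ge0// !sqrf_eq0.
apply/negP => /andP[/eqP E1]; rewrite mulf_eq0 (gt_eqF y0) orbF => /eqP c0.
move: E1 det1; rewrite c0 mul0r add0r => ->; rewrite !mulr0 subr0 => /esym/eqP.
by rewrite oner_eq0.
Qed.

Local Notation "u ⊕ v" := (RAdd u v) (at level 50, left associativity).
Local Notation "u ⊗ v" := (RMul u v) (at level 40, left associativity).
Definition em1 : @rexpr R := RC c ⊗ RX ⊕ RC d.
Definition em2 : @rexpr R := RC c ⊗ RY.
Definition eM := em1 ⊗ em1 ⊕ em2 ⊗ em2.
Definition eY := RY ⊗ RInv eM.
Definition eX := (RC (a * c) ⊗ (RX ⊗ RX ⊕ RY ⊗ RY) ⊕ RC (a * d + b * c) ⊗ RX ⊕ RC (b * d))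
  ⊗ RInv eM.

Lemma eM_neq0 x y u v : 0 < y -> reval eM (pt x y u v) != 0.
Proof. by move=> y0; rewrite /= !ptE -!expr2 gt_eqF// denom_gt0. Qed.

Lemma base_reval p : H p -> h p 0 1 = reval eY p /\ h p 0 0 = reval eX p.
Proof.
move=> /H2C_y y0; rewrite -(ptK p) !(fibre_const k_gt0 hI)//.
by have [-> ->] := mob (p 0 0) y0; rewrite /= !ptE -!expr2.
Qed.

(** Explicit also away from the zero section, since the base components of h do
    not depend on w. *)
Lemma base_Jac x y u v (i : 'I_4) : 0 < y -> let p := pt x y u v in
  J p i 1 = reval (rderiv i eY) p /\ J p i 0 = reval (rderiv i eX) p.
Proof.
move=> y0 p; have Hp : H p by rewrite H_pt.
have Mn := eM_neq0 x u v y0.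
rewrite !JacE; split.
  rewrite (partial_eq_on i (@H2C_open R) Hp (G := reval eY)); last by move=> q /base_reval[].
  by rewrite reval_partial//=; do !split.
rewrite (partial_eq_on i (@H2C_open R) Hp (G := reval eX)); last by move=> q /base_reval[].
by rewrite reval_partial//=; do !split.
Qed.

(** At w = 1 the map of the fibre is multiplication by the value of h, of norm
    (y / Im h)^(3/2) = |c z + d|^3 because h preserves the fibre norm. *)
Lemma fibre_conformal x y : 0 < y -> let p := pt x y 1 0 in
  let M := (c * x + d) ^+ 2 + (c * y) ^+ 2 in
  [/\ J p 2 2 = h p 0 2, J p 2 3 = h p 0 3, J p 3 2 = - h p 0 3, J p 3 3 = h p 0 2 &
      h p 0 2 ^+ 2 + h p 0 3 ^+ 2 = M ^+ 3].
Proof.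
move=> y0 p M.
have Mn : M != 0 by rewrite gt_eqF// denom_gt0.
have yn : y != 0 by rewrite gt_eqF.
have [W E1 E2 E3] := fibre_wedge_iso k_gt0 hI x y0.
have W0 := fibre_pos x y0; rewrite W in W0.
have YM : h (pt x y 0 0) 0 1 = y / M by have [-> _] := mob x y0.
have S t : h (pt x y 0 0) 0 1 ^+ 3 * t = y ^+ 3 -> t = M ^+ 3.
  move=> E; apply: (mulfI (_ : (y / M) ^+ 3 != 0)).
    by rewrite expf_neq0// mulf_neq0// invr_neq0.
  by rewrite -YM E YM; field; rewrite ?Mn.
have [J32 J33] := conformal_positive (S _ E1) (S _ E2) E3 W0.
have F (i j : 'I_4) := @Jac_fibre_fibre _ _ k_gt0 _ hI x y 1 0 i j y0.
have L j := fibre_linear k_gt0 hI x 1 0 y0 (j := j).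
rewrite /p !F// !(L 2)// !(L 3)// !mul1r !mul0r !addr0 J32 J33; split=> //.
exact: S.
Qed.

(** With rho = U + i W and m = c z + d this is d rho = 3 c rho dz / m. It comes
    from the mixed block of the isometry equation: four linear equations for
    the four derivatives of U and W. *)
Lemma fibre_transport x y : 0 < y -> let p := pt x y 1 0 in
  let m1 := c * x + d in let m2 := c * y in let M := m1 ^+ 2 + m2 ^+ 2 in
  let U := h p 0 2 in let W := h p 0 3 in
  [/\ J p 0 2 = 3 * c * (U * m1 + W * m2) / M, J p 0 3 = 3 * c * (W * m1 - U * m2) / M,
      J p 1 2 = - (3 * c * (W * m1 - U * m2) / M) & J p 1 3 = 3 * c * (U * m1 + W * m2) / M].
Proof.
move=> y0 p m1 m2 M U W.
have Hp : H p by rewrite H_pt.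
have Mn : M != 0 by rewrite gt_eqF// denom_gt0.
have yn : y != 0 by rewrite gt_eqF.
have kn := lt0r_neq0 k_gt0.
have [J22 J23 J32 J33 N] := fibre_conformal x y0.
have F (i j : 'I_4) := @Jac_fibre_base _ _ k_gt0 _ hI x y 1 0 i j y0.
have z := (F 2 0 isT isT, F 2 1 isT isT, F 3 0 isT isT, F 3 1 isT isT).
have Yp : h p 0 1 = y / M.
  by have [-> _] := base_reval Hp; rewrite /= !ptE -!expr2.
have [J01 J00] := base_Jac x 1 0 0 y0; have [J11 J10] := base_Jac x 1 0 1 y0.
have e00 : J p 0 0 = (a * d - b * c) * (m1 ^+ 2 - m2 ^+ 2) / M ^+ 2.
  by rewrite J00 /= !ptE /M /m1 /m2; field; rewrite -?expr2 ?Mn.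
have e01 : J p 0 1 = - 2 * m1 * m2 / M ^+ 2.
  by rewrite J01 /= !ptE /M /m1 /m2; field; rewrite -?expr2 ?Mn.
have e10 : J p 1 0 = (a * d - b * c) * (2 * m1 * m2) / M ^+ 2.
  by rewrite J10 /= !ptE /M /m1 /m2; field; rewrite -?expr2 ?Mn.
have e11 : J p 1 1 = (m1 ^+ 2 - m2 ^+ 2) / M ^+ 2.
  by rewrite J11 /= !ptE /M /m1 /m2; field; rewrite -?expr2 ?Mn.
rewrite det1 mul1r in e00 e10.
have /matrixP Iso := iso_metric hI Hp.
have E i j : _ = G p i j := Iso i j.
have := E 0 2; have := E 0 3; have := E 1 2; have := E 1 3.
rewrite !mulmx4E ![(_^T) _ _]mxE !z J22 J23 J32 J33 e00 e01 e10 e11 !mxE /= !ptE Yp -/U -/W.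
have {}N : U ^+ 2 + W ^+ 2 = M ^+ 3 := N.
move: {E Iso z F J22 J23 J32 J33 J00 J01 J10 J11 e00 e01 e10 e11}
  (J p 0 2) (J p 0 3) (J p 1 2) (J p 1 3) U W N => u0 w0 u1 w1 U W N E13 E12 E03 E02.
have Mr : M = m1 ^+ 2 + m2 ^+ 2 by [].
have m2r : m2 = c * y by [].
clearbody m1 m2 M; move: Mr E02 E03 E12 E13; rewrite {}m2r => {m2} Mr E02 E03 E12 E13.
pose c1 := - (3 * M ^+ 3) / (4 * k * y ^+ 3).
have lin3 (A B x1 y1 x2 y2 x3 y3 d1 d2 d3 : R) : x1 = y1 -> x2 = y2 -> x3 = y3 ->
    A - B = d1 * (x1 - y1) + d2 * (x2 - y2) + d3 * (x3 - y3) -> A = B.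
  by move=> -> -> ->; rewrite !subrr !mulr0 !addr0 => /eqP; rewrite subr_eq0 => /eqP.
(* The first relation combined is one entry of the isometry equation; the other
   two are |rho|^2 = |m|^6 and M = |m|^2. *)
have S0 : U * u0 + W * w0 = 3 * c * m1 * M ^+ 2.
  apply: (lin3 _ _ _ _ _ _ _ _ c1 (3 * m1 * c / M) 0 E02 N Mr).
  by rewrite /c1; field; rewrite ?yn ?Mn ?kn.
have T0 : U * w0 - W * u0 = - 3 * c * (c * y) * M ^+ 2.
  apply: (lin3 _ _ _ _ _ _ _ _ c1 (3 / 2 * (m1 ^+ 2 - (c * y) ^+ 2) / (M * y))
    (- (3 / 2) * M ^+ 2 / y) E03 N Mr).
  by rewrite /c1; field; rewrite ?yn ?Mn ?kn.
have S1 : U * u1 + W * w1 = 3 * c * (c * y) * M ^+ 2.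
  apply: (lin3 _ _ _ _ _ _ _ _ c1 (- (3 / 2) * (m1 ^+ 2 - (c * y) ^+ 2) / (M * y))
    (3 / 2 * M ^+ 2 / y) E12 N Mr).
  by rewrite /c1; field; rewrite ?yn ?Mn ?kn.
have T1 : U * w1 - W * u1 = 3 * c * m1 * M ^+ 2.
  apply: (lin3 _ _ _ _ _ _ _ _ c1 (3 * m1 * c / M) 0 E13 N Mr).
  by rewrite /c1; field; rewrite ?yn ?Mn ?kn.
have M3n : M ^+ 3 != 0 by rewrite expf_neq0.
have solve_u u w : M ^+ 3 * u = U * (U * u + W * w) - W * (U * w - W * u).
  by rewrite -N; ring.
have solve_w u w : M ^+ 3 * w = W * (U * u + W * w) + U * (U * w - W * u).
  by rewrite -N; ring.
split; apply: (mulfI M3n).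
- by rewrite (solve_u _ w0) S0 T0; field; rewrite ?Mn.
- by rewrite (solve_w u0) S0 T0; field; rewrite ?Mn.
- by rewrite (solve_u _ w1) S1 T1; field; rewrite ?Mn.
- by rewrite (solve_w u1) S1 T1; field; rewrite ?Mn.
Qed.

(** The real part of (c z + d)^3; [eim] is the imaginary part. *)
Definition ere := em1 ⊗ em1 ⊗ em1 ⊕ RC (-3) ⊗ em1 ⊗ em2 ⊗ em2.
Definition eim := RC 3 ⊗ em1 ⊗ em1 ⊗ em2 ⊕ ROpp (em2 ⊗ em2 ⊗ em2).
Definition eM3 := eM ⊗ eM ⊗ eM.
(** The real part of rho / (c z + d)^3 for rho the value of h at w = 1; [sigma2]
    is the imaginary part. *)
Definition sigma1 :=
  comb3 (fun q => h q 0 2) (fun q => h q 0 3) (fun q => h q 0 2)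
    (ere ⊗ RInv eM3) (eim ⊗ RInv eM3) (RC 0).
Definition sigma2 :=
  comb3 (fun q => h q 0 3) (fun q => h q 0 2) (fun q => h q 0 2)
    (ere ⊗ RInv eM3) (ROpp (eim ⊗ RInv eM3)) (RC 0).

(** The equation d rho = 3 c rho dz / m says that rho / m^3 has derivative zero. *)
Lemma sigma_const x y : 0 < y ->
  sigma1 (pt x y 1 0) = sigma1 (pt 0 1 1 0) /\ sigma2 (pt x y 1 0) = sigma2 (pt 0 1 1 0).
Proof.
have aux (x' y' : R) : 0 < y' -> let p := pt x' y' 1 0 in
   [/\ differentiable (fun q => h q 0 2) p, differentiable (fun q => h q 0 3) p,
       rdef (ere ⊗ RInv eM3) p, rdef (eim ⊗ RInv eM3) p & reval eM p != 0].
  move=> y'0 p; have Hp : H p by rewrite H_pt.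
  have Mn := eM_neq0 x' 1 0 y'0.
  split=> //; try exact: (h_entry_diff hI _ Hp).
    by do ![split=> //]; rewrite /= !mulf_neq0.
  by do ![split=> //]; rewrite /= !mulf_neq0.
move=> y0; split; apply: slice_const => // x' y' y'0.
  have [d2 d3 r1 r2 Mn] := aux x' y' y'0.
  have r0 : rdef (RC 0 : @rexpr R) (pt x' y' 1 0) := I.
  have [dc p0] := comb3_partial 0 d2 d3 d2 r1 r2 r0.
  have [_ p1] := comb3_partial 1 d2 d3 d2 r1 r2 r0.
  have [J02 J03 J12 J13] := fibre_transport x' y'0.
  split; first exact: dc.
    rewrite p0 -!JacE J02 J03; move: Mn; rewrite /= !ptE => Mn.
    by field; rewrite -?expr2 ?Mn.
  rewrite p1 -!JacE J12 J13; move: Mn; rewrite /= !ptE => Mn.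
  by field; rewrite -?expr2 ?Mn.
have [d2 d3 r1 r2 Mn] := aux x' y' y'0.
have r2' : rdef (ROpp (eim ⊗ RInv eM3)) (pt x' y' 1 0) := r2.
have r0 : rdef (RC 0 : @rexpr R) (pt x' y' 1 0) := I.
have [dc p0] := comb3_partial 0 d3 d2 d2 r1 r2' r0.
have [_ p1] := comb3_partial 1 d3 d2 d2 r1 r2' r0.
have [J02 J03 J12 J13] := fibre_transport x' y'0.
split; first exact: dc.
  rewrite p0 -!JacE J02 J03; move: Mn; rewrite /= !ptE => Mn.
  by field; rewrite -?expr2 ?Mn.
rewrite p1 -!JacE J12 J13; move: Mn; rewrite /= !ptE => Mn.
by field; rewrite -?expr2 ?Mn.
Qed.

Lemma fibre_rotation : exists theta : R, forall x y, 0 < y ->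
  let m1 := c * x + d in let m2 := c * y in
  let re := m1 ^+ 3 - 3 * m1 * m2 ^+ 2 in let im := 3 * m1 ^+ 2 * m2 - m2 ^+ 3 in
  h (pt x y 1 0) 0 2 = cos theta * re - sin theta * im /\
  h (pt x y 1 0) 0 3 = cos theta * im + sin theta * re.
Proof.
have E x y : 0 < y ->
    let m1 := c * x + d in let m2 := c * y in
    let re := m1 ^+ 3 - 3 * m1 * m2 ^+ 2 in let im := 3 * m1 ^+ 2 * m2 - m2 ^+ 3 in
    let s1 := sigma1 (pt 0 1 1 0) in let s2 := sigma2 (pt 0 1 1 0) in
    [/\ h (pt x y 1 0) 0 2 = s1 * re - s2 * im, h (pt x y 1 0) 0 3 = s1 * im + s2 * re
      & s1 ^+ 2 + s2 ^+ 2 = 1].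
  move=> y0 m1 m2 re im s1 s2.
  have [e1 e2] := sigma_const x y0; rewrite /s1 /s2 -e1 -e2.
  have Mn := lt0r_neq0 (denom_gt0 x y0).
  have [_ _ _ _ N] := fibre_conformal x y0.
  rewrite -/m1 -/m2 in Mn N.
  rewrite /sigma1 /sigma2 /comb3 /= !ptE -/m1 -/m2 /re /im.
  move: N; move: (h _ 0 2) (h _ 0 3) => U W N.
  split.
  - by field; rewrite -?expr2 ?Mn.
  - by field; rewrite -?expr2 ?Mn.
  apply: (@eq_lincomb _ _ _ ((m1 ^+ 2 + m2 ^+ 2) ^- 3) _ _ N).
  by field; rewrite -?expr2 ?Mn.
have [_ _ /unit_circle[theta [ct st]]] := E 0 1 ltr01.
by exists theta => x y y0; rewrite ct st; have [] := E x y y0.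
Qed.

End MobiusBase.

(** The two signs exclude the isometries that reverse the orientation of the base
    or of the fibres, such as (z, w) |-> (- conj z, conj w). *)
Theorem chart_rigidity :
  base_wedge (h (pt 0 1 0 0)) (h (pt 0 2 0 0)) (h (pt 1 1 0 0)) < 0 ->
  (forall x y, 0 < y -> 0 < fibre_wedge (h (pt x y 1 0)) (h (pt x y 0 1))) ->
  exists a b c d theta : R, a * d - b * c = 1 /\ forall x y u v, 0 < y ->
    let m1 := c * x + d in let m2 := c * y in let M := m1 ^+ 2 + m2 ^+ 2 in
    let re := m1 ^+ 3 - 3 * m1 * m2 ^+ 2 in let im := 3 * m1 ^+ 2 * m2 - m2 ^+ 3 in
    let u' := cos theta * u - sin theta * v in let v' := cos theta * v + sin theta * u in
    M != 0 /\
    h (pt x y u v) = pt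
      ((a * c * (x ^+ 2 + y ^+ 2) + (a * d + b * c) * x + b * d) / M) (y / M)
      (re * u' - im * v') (re * v' + im * u').
Proof.
move=> bw fibre_pos.
have d0 : 0 < Jac h (pt 0 1 0 0) 0 0 * Jac h (pt 0 1 0 0) 1 1
            - Jac h (pt 0 1 0 0) 0 1 * Jac h (pt 0 1 0 0) 1 0.
  move: bw; rewrite (base_wedge_iso k_gt0 hI).
  have Y0 := h_y_gt0 hI (0 : R) (0 : R) (0 : R) ltr01.
  by rewrite pmulr_llt0 ?invr_gt0 ?exprn_gt0// nmulr_rlt0// oppr_lt0 divr_gt0.
have [a [b [c [d [det1 mob]]]]] := base_mobius k_gt0 hI d0.
have [theta rot] := fibre_rotation det1 mob fibre_pos.
exists a, b, c, d, theta; split=> // x y u v y0 m1 m2 M re im u' v'.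
have Mn : M != 0 by rewrite gt_eqF// (denom_gt0 det1).
split=> //.
have [eY eX] := mob x y y0.
have L (s t : R) (j : 'I_4) := fibre_linear k_gt0 hI x s t y0 (j := j).
have [J22 J23 J32 J33 _] := fibre_conformal det1 mob fibre_pos x y0.
have F (i j : 'I_4) := @Jac_fibre_fibre _ _ k_gt0 _ hI x y 1 0 i j y0.
have [r2 r3] := rot x y y0.
apply: row4P; rewrite !ptE.
- by rewrite (fibre_const k_gt0 hI).
- by rewrite (fibre_const k_gt0 hI).
- rewrite (L u v 2)// -(F 2 2 isT isT) -(F 3 2 isT isT) J22 J32 r2 r3 /u' /v' /re /im /m1 /m2; ring.
- rewrite (L u v 3)// -(F 2 3 isT isT) -(F 3 3 isT isT) J23 J33 r2 r3 /u' /v' /re /im /m1 /m2; ring.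
Qed.

End Rotation.

(** * From isometries of the upper half-space to their coordinates *)

Section FromIsometry.
Context {R : realType} (k : R) (k_gt0 : 0 < k).
Local Notation V := 'rV[R]_4.
Local Notation H := (H2C R).
Local Notation g := (neutral_metric (fun t : R => - k * t)).

Lemma in_coords_val (h : H2C R -> H2C R) (p : H2C R) :
  in_coords h (set_val p) = set_val (h p).
Proof. by rewrite /in_coords -[LHS]/(sigL H (valL_ 0 (set_val \o h)) p) valLK. Qed.

Lemma H2C_point (p : V) : H p -> exists q : H2C R, set_val q = p.
Proof. by move=> Hp; exists (SigSub (mem_set Hp)). Qed.

Lemma jacobianE (f : V -> V) p : differentiable f p -> jacobian f p = Jac f p.
Proof.
move=> df; apply/row_matrixP => i.
rewrite rowE -deriveEjacobian// derive_mx; last exact: diff_derivable.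
apply/matrixP => a j; rewrite !mxE JacE ord1 partialE; last exact: (differentiable_entry 0 j df).
by rewrite deriveE//; exact: (differentiable_entry 0 j df).
Qed.

Lemma isometry_chart (h : H2C R -> H2C R) : Defs.isometry g h -> chart_isometry k (in_coords h).
Proof.
move=> [[sm _] me].
have hH p : H p -> H (in_coords h p).
  by move=> /H2C_point[q <-]; rewrite in_coords_val; exact: set_valP.
have hd p : H p -> differentiable (in_coords h) p.
  by move=> Hp; have [d _] := sm 1%N; exact: d.
split=> //.
  by move=> j; apply: is_Cn_diff_upto; [exact: H2C_open|exact: (sm 4%N)].
move=> p Hp; have Hhp := hH p Hp; move: (Hp) (Hhp) => /H2C_point[q qp].
have := me q; rewrite /= -in_coords_val qp jacobianE; last exact: hd.
by rewrite !metricE//; apply/lt0r_neq0/H2C_y.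
Qed.

End FromIsometry.

(** * Orientation is constant on the identity component *)

Section Orientation.
Context {R : realType}.
Local Notation V := 'rV[R]_4.
Local Notation T := {compact-open, H2C R -> H2C R}.

(** Points are compact. *)
Lemma compact_open_eval (X Y : topologicalType) (x : X) :
  continuous (fun f : {compact-open, X -> Y} => f x).
Proof.
move=> f A /= nA; move: (nA); rewrite nbhsE; case=> O [oO Ofx] OA.
have : nbhs f [set g : {compact-open, X -> Y} | g @` [set x] `<=` O].
  apply: open_nbhs_nbhs; split; first
    exact: (@compact_open_open X Y [set x] O (@compact_set1 _ x) oO).
  by move=> _ [_ -> <-].
by apply: filterS => g gO; apply: OA; apply: gO; exists x.
Qed.

Lemma eval_continuous (p : H2C R) : continuous (fun h : T => set_val (h p) : V).
Proof.
move=> h; apply: (@continuous_comp _ _ _ (fun f : T => f p) set_val).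
  exact: compact_open_eval.
exact: initial_continuous.
Qed.

Lemma reval_eval_continuous (e : @rexpr R) (p : H2C R) (h : T) :
  rdef e (set_val (h p)) -> {for h, continuous (fun f : T => reval e (set_val (f p)))}.
Proof.
move=> de; apply: (@continuous_comp _ _ _ (fun f : T => set_val (f p) : V) (reval e)).
  exact: eval_continuous.
exact/differentiable_continuous/reval_diff.
Qed.

(** The points where D is positive are those where D is nonnegative: an open and
    closed part of A. *)
Lemma connected_sign (X : topologicalType) (A : set X) (D : X -> R) (x0 x : X) :
  connected A -> continuous D -> (forall x, A x -> D x != 0) ->
  A x0 -> 0 < D x0 -> A x -> 0 < D x.
Proof.
move=> cA cD D0 Ax0 Dx0 Ax.
suff E : [set x | A x /\ 0 < D x] = A by move: Ax; rewrite -E; case.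
apply: cA; first by exists x0.
  exists (D @^-1` [set y | 0 < y]); last by rewrite predeqE.
  by apply: open_comp; [move=> z _; exact: cD|exact: open_gt].
exists (D @^-1` [set y | 0 <= y]).
  by apply: closed_comp; [move=> z _; exact: cD|exact: closed_ge].
rewrite predeqE => z; split; case=> Az Dz; split=> //=; first exact: ltW.
by rewrite lt_def D0.
Qed.

End Orientation.

Section Continuity.
Context {R : realType}.
Local Notation V := 'rV[R]_4.
Local Notation T := {compact-open, H2C R -> H2C R}.

Definition hpt (x y u v : R) (y0 : 0 < y) : H2C R :=
  SigSub (mem_set (eq_ind_r id y0 (H_pt x y u v)) : pt x y u v \in H2C R).

Lemma hptE (x y u v : R) (y0 : 0 < y) : set_val (hpt x u v y0) = pt x y u v.
Proof. by []. Qed.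

Lemma base_wedge_continuous (p1 p2 p3 : H2C R) :
  continuous (fun h : T => base_wedge (set_val (h p1)) (set_val (h p2)) (set_val (h p3))).
Proof.
move=> h.
have d (p : H2C R) : set_val (h p) 0 1 != 0 :> R.
  exact/lt0r_neq0/H2C_y/set_valP.
have c (e : @rexpr R) (p : H2C R) : rdef e (set_val (h p)) ->
  {for h, continuous (fun f : T => reval e (set_val (f p)))} := @reval_eval_continuous R e p h.
have c1 p := c hyperboloid1 p (conj I (d p)).
have c2 p := c hyperboloid2 p (conj I (conj I (d p))).
have c3 p := c hyperboloid3 p (conj (conj (conj I I) (conj I I)) (conj I (d p))).
rewrite /base_wedge; cbv zeta.
have cw p q : {for h, continuous (fun f : T =>
    reval hyperboloid2 (set_val (f p)) * reval hyperboloid3 (set_val (f q))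
    - reval hyperboloid3 (set_val (f p)) * reval hyperboloid2 (set_val (f q)))}.
  exact: (continuousB (continuousM (c2 p) (c3 q)) (continuousM (c3 p) (c2 q))).
exact: (continuousD (continuousB (continuousM (c1 p1) (cw p2 p3)) (continuousM (c1 p2) (cw p1 p3)))
  (continuousM (c1 p3) (cw p1 p2))).
Qed.

Lemma fibre_wedge_continuous (p1 p2 : H2C R) :
  continuous (fun h : T => fibre_wedge (set_val (h p1)) (set_val (h p2))).
Proof.
move=> h; rewrite /fibre_wedge.
have c2 p := @reval_eval_continuous R RU p h I.
have c3 p := @reval_eval_continuous R RV p h I.
exact: (continuousB (continuousM (c2 p1) (c3 p2)) (continuousM (c3 p1) (c2 p2))).
Qed.

End Continuity.

(** * The actions in coordinates, and the classification *)

Section ActionFormula.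
Context {R : realType}.
Local Open Scope complex_scope.

(** With m = c z + d, the base point is (a z + b) conj m / |m|^2 and the fibre
    coordinate is m^3 e^(i theta) w, separated into real and imaginary parts. *)
Lemma SL2_act_rot_actE (P : 'M[R]_2) (theta x y u v : R) :
  let a := P 0 0 in let b := P 0 1 in let c := P 1 0 in let d := P 1 1 in
  let m1 := c * x + d in let m2 := c * y in let M := m1 ^+ 2 + m2 ^+ 2 in
  let re := m1 ^+ 3 - 3 * m1 * m2 ^+ 2 in let im := 3 * m1 ^+ 2 * m2 - m2 ^+ 3 in
  let u' := cos theta * u - sin theta * v in let v' := cos theta * v + sin theta * u in
  a * d - b * c = 1 -> M != 0 ->
  SL2_act P (rot_act theta (pt x y u v)) =
    pt ((a * c * (x ^+ 2 + y ^+ 2) + (a * d + b * c) * x + b * d) / M) (y / M)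
       (re * u' - im * v') (re * v' + im * u').
Proof.
move=> a b c d m1 m2 M re im u' v' det1 M0; apply/esym.
rewrite /SL2_act /rot_act -/a -/b -/c -/d.
have zE (s t f g : R) : zcoord (mkpt (s +i* t) (f +i* g)) = s +i* t.
  by rewrite /zcoord !mxE.
have wE (s t f g : R) : wcoord (mkpt (s +i* t) (f +i* g)) = f +i* g.
  by rewrite /wcoord !mxE.
have z0 : zcoord (pt x y u v) = x +i* y by rewrite /zcoord !ptE.
have w0 : wcoord (pt x y u v) = u +i* v by rewrite /wcoord !ptE.
rewrite z0 w0.
have -> : (cos theta +i* sin theta) * (u +i* v) = u' +i* v' by [].
rewrite zE wE.
have mE : c%:C * (x +i* y) + d%:C = m1 +i* m2.
  by apply/eqP; rewrite eq_complex /=; apply/andP; split; apply/eqP; rewrite /m1 /m2; ring.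
rewrite mE.
have mn : m1 +i* m2 != 0.
  rewrite eq_complex /=; apply: contraNN M0 => /andP[/eqP m10 /eqP m20].
  by rewrite /M m10 m20 !expr0n addr0.
have quot : (a%:C * (x +i* y) + b%:C) / (m1 +i* m2) =
    ((a * c * (x ^+ 2 + y ^+ 2) + (a * d + b * c) * x + b * d) / M) +i* (y / M).
  apply: (canLR (mulfK mn)); apply/eqP; rewrite eq_complex /=.
  have M0' : (c * x + d) ^+ 2 + (c * y) ^+ 2 != 0 := M0.
  apply/andP; split; apply/eqP; rewrite /M /m1 /m2.
    by apply: (@eq_lincomb _ _ _ (- (c * y ^+ 2 / M)) _ _ det1); rewrite /M /m1 /m2;
      field; rewrite ?M0'.
  by apply: (@eq_lincomb _ _ _ (y * (c * x + d) / M) _ _ det1); rewrite /M /m1 /m2;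
    field; rewrite ?M0'.
have cube : (m1 +i* m2) ^+ 3 = (m1 ^+ 3 - 3 * m1 * m2 ^+ 2) +i* (3 * m1 ^+ 2 * m2 - m2 ^+ 3).
  rewrite !exprS expr0 mulr1; apply/eqP; rewrite eq_complex /=.
  by apply/andP; split; apply/eqP; ring.
rewrite quot cube.
by apply: row4P; rewrite !ptE ?mxE /= /re /im /u' /v' //; ring.
Qed.

End ActionFormula.

(* An element of PSL(2, R) is given by a representative P in SL(2, R). *)
Theorem theoremB (R : realType) (k : R) (k_gt0 : 0 < k)
    (h : H2C R -> H2C R)
    (h_Isom0 : Isom0 (neutral_metric (fun t : R => - k * t)) h) :
  exists (P : 'M[R]_2) (theta : R),
    \det P = 1 /\
    forall p : H2C R, set_val (h p) = SL2_act P (rot_act theta (set_val p)).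
Proof.
have [C [Cid CI cC] Ch] := h_Isom0.
have chart (f : H2C R -> H2C R) : C f -> chart_isometry k (in_coords f).
  by move=> Cf; apply: isometry_chart; exact: CI.
have cval (f : H2C R -> H2C R) (x y u v : R) (y0 : 0 < y) :
    set_val (f (hpt x u v y0)) = in_coords f (pt x y u v).
  by rewrite -in_coords_val.
have hI := chart h Ch.
have t20 : (0 : R) < 2 by [].
have bw : base_wedge (in_coords h (pt 0 1 0 0)) (in_coords h (pt 0 2 0 0))
    (in_coords h (pt 1 1 0 0)) < 0.
  rewrite -(cval h 0 1 0 0 ltr01) -(cval h 0 2 0 0 t20) -(cval h 1 1 0 0 ltr01) -oppr_gt0.
  pose D (f : {compact-open, H2C R -> H2C R}) := - base_wedge
     (set_val (f (hpt 0 0 0 ltr01))) (set_val (f (hpt 0 0 0 t20))) (set_val (f (hpt 1 0 0 ltr01))).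
  apply: (@connected_sign _ _ C D id h cC _ _ Cid _ Ch).
  - by move=> f; exact: (continuousN (@base_wedge_continuous R _ _ _ f)).
  - move=> f Cf; rewrite /D oppr_eq0 !cval; exact: (base_wedge_neq0 k_gt0 (chart f Cf)).
  - rewrite /D !hptE /base_wedge /= !ptE; lra.
have fibre_pos (x y : R) : 0 < y ->
    0 < fibre_wedge (in_coords h (pt x y 1 0)) (in_coords h (pt x y 0 1)).
  move=> y0; rewrite -(cval h x y 1 0 y0) -(cval h x y 0 1 y0).
  pose D (f : {compact-open, H2C R -> H2C R}) := fibre_wedge
     (set_val (f (hpt x 1 0 y0))) (set_val (f (hpt x 0 1 y0))).
  apply: (@connected_sign _ _ C D id h cC _ _ Cid _ Ch).
  - exact: fibre_wedge_continuous.
  - move=> f Cf; rewrite /D !cval; exact: (fibre_wedge_neq0 k_gt0 (chart f Cf) _ y0).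
  - by rewrite /D !hptE /fibre_wedge !ptE mulr1 mulr0 subr0 ltr01.
have [a [b [c [d [theta [det1 E]]]]]] := chart_rigidity k_gt0 hI bw fibre_pos.
exists (\matrix_(i, j) nth 0 (nth [::] [:: [:: a; b]; [:: c; d]] i) j), theta.
set P := \matrix_(i, j) _.
have Pe : [/\ P 0 0 = a, P 0 1 = b, P 1 0 = c & P 1 1 = d] by rewrite !mxE.
split.
  rewrite (expand_det_row _ 0) !big_ord_recl big_ord0 /cofactor !det_mx11 !mxE /=.
  by rewrite /bump leqnn !add0n !addn0 /= expr0 expr1; apply: etrans det1; ring.
move=> p; rewrite -in_coords_val -(ptK (set_val p)).
have y0 : 0 < set_val p 0 1 by exact/H2C_y/set_valP.
have [Mn ->] := E (set_val p 0 0) (set_val p 0 1) (set_val p 0 2) (set_val p 0 3) y0.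
by case: Pe Mn det1 => <- <- <- <- Mn det1; rewrite SL2_act_rot_actE.
Qed.
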